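(* For $\alpha\in\mathbb{C}$ let $\mathcal{W}_\alpha=\{W_{a,b}\}_{a,b\in\{0,1\}}$ be the two-sender classical-quantum multiple access channel with coherent-state outputs $W_{a,b}=|((-1)^a+(-1)^b)\alpha\rangle\langle((-1)^a+(-1)^b)\alpha|$, and let $$C_{\mathrm{SD}}(\mathcal{W}_\alpha)=\max_{P_A\times P_B}\min\Big(I(A;Y|B)_{P_A\times P_B},\ I(B;Y|A)_{P_A\times P_B},\ \tfrac12I(AB;Y)_{P_A\times P_B}\Big)$$ be the rate of simultaneously-decodable codes. Then $$\lim_{|\alpha|\to\infty}C_{\mathrm{SD}}(\mathcal{W}_\alpha)=\frac{I_{\max,\infty}}{2},$$ where $$I_{\max,\infty}=\max_{P_A,P_B}\Big[\eta\big(P_A(0)P_B(1)+P_A(1)P_B(0)\big)+\eta\big(P_A(0)P_B(0)\big)+\eta\big(P_A(1)P_B(1)\big)\Big],\qquad \eta(t)=-t\log t .$$ Here all maxima are over probability distributions $P_A,P_B$ on $\{0,1\}$.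
   Context: **Notation.** $\log$ is to any fixed base, the same throughout, and $\eta(0)=0$. The coherent state is $|\beta\rangle=e^{-|\beta|^2/2}\sum_{m\ge0}\frac{\beta^m}{\sqrt{m!}}|m\rangle$ in the Fock space with orthonormal number basis $\{|m\rangle\}_{m\ge0}$. $H[\rho]=-\mathrm{Tr}\,\rho\log\rho$ is the von Neumann entropy. **Mutual informations.** With $A\sim P_A$, $B\sim P_B$ independent and $Y$ the output quantum system in state $W_{A,B}$: - $I(AB;Y)_{P_A\times P_B}=H\big[\sum_{a,b}P_A(a)P_B(b)W_{a,b}\big]-\sum_{a,b}P_A(a)P_B(b)H[W_{a,b}]$; - $I(A;Y|B)_{P_A\times P_B}=\sum_bP_B(b)\Big(H\big[\sum_aP_A(a)W_{a,b}\big]-\sum_aP_A(a)H[W_{a,b}]\Big)$; - $I(B;Y|A)_{P_A\times P_B}$ is defined symmetrically. *)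

(* Defs.v *)
From HB Require Import structures.
From mathcomp Require Import all_boot all_order all_algebra.
From mathcomp Require Import complex.
From mathcomp Require Import all_classical all_reals all_analysis.
Import Order.TTheory GRing.Theory Num.Theory.
Import numFieldNormedType.Exports.

Set Implicit Arguments.
Unset Strict Implicit.
Unset Printing Implicit Defensive.

Local Open Scope classical_set_scope.
Local Open Scope ring_scope.
Local Open Scope complex_scope.

(* Series of complex numbers, componentwise. *)
Definition has_csum (R : realType) (u : nat -> R[i]) (l : R[i]) : Prop :=
  series (fun n => complex.Re (u n)) @ \oo --> complex.Re l /\
  series (fun n => complex.Im (u n)) @ \oo --> complex.Im l.

Definition csum (R : realType) (u : nat -> R[i]) : R[i] :=
  limn (series (fun n => complex.Re (u n))) +i*
  limn (series (fun n => complex.Im (u n))).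

(* The Fock space is l^2(nat): a vector is the sequence of its coordinates in
   the number basis, subject to [square_summable]. An operator T is given by its
   matrix elements T m n = <m|T|n> in that basis. *)
Definition fvec (R : realType) : Type := nat -> R[i].
Definition fop (R : realType) : Type := nat -> nat -> R[i].

Definition square_summable (R : realType) (u : fvec R) : Prop :=
  cvgn (series (fun n => Normc.normc (u n) ^+ 2)).

(* <u|v>, antilinear in u *)
Definition inner (R : realType) (u v : fvec R) : R[i] :=
  csum (fun n => conjc (u n) * v n).

(* |u><v| *)
Definition ketbra (R : realType) (u v : fvec R) : fop R :=
  fun m n => u m * conjc (v n).

Definition optrace (R : realType) (T : fop R) : R[i] := csum (fun n => T n n).

Definition coherent (R : realType) (beta : R[i]) : fvec R :=
  fun m => (expR (- (Normc.normc beta ^+ 2 / 2)))%:C *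
           (beta ^+ m / (Num.sqrt (m`!%:R : R))%:C).

(* Spectral decomposition rho = sum_k lam_k |e_k><e_k| of a positive trace-class
   operator. The e_k with lam_k <> 0 are orthonormal; those with lam_k = 0 are
   unconstrained and contribute nothing, so that finite-rank rho are covered and
   the kernel of rho is left out. *)
Definition spectral_decomp (R : realType) (rho : fop R)
    (lam : nat -> R) (e : nat -> fvec R) : Prop :=
  [/\ forall k, 0 <= lam k,
      cvgn (series lam),
      forall k, lam k != 0 -> square_summable (e k),
      forall j k, lam j != 0 -> lam k != 0 -> inner (e j) (e k) = (j == k)%:R &
      forall m n,
        has_csum (fun k => (lam k)%:C * ketbra (e k) (e k) m n) (rho m n)].

Definition the_spectral_decomp (R : realType) (rho : fop R) :
    (nat -> R) * (nat -> fvec R) :=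
  xget (fun=> 0, fun _ _ => 0) [set p | spectral_decomp rho p.1 p.2].

(* Functional calculus f(rho), for positive trace-class rho and f 0 = 0; under
   the latter condition the result does not depend on the decomposition. *)
Definition op_fun (R : realType) (f : R -> R) (rho : fop R) : fop R :=
  let: (lam, e) := the_spectral_decomp rho in
  fun m n => csum (fun k => (f (lam k))%:C * ketbra (e k) (e k) m n).

(* Logarithm to base b > 1; [ln] is 0 at 0, hence 0 log 0 = 0. *)
Definition logb (R : realType) (b t : R) : R := ln t / ln b.

Definition eta (R : realType) (b t : R) : R := - t * logb b t.

(* H[rho] = - Tr (rho log rho). The trace is real, as rho is positive. *)
Definition vN_entropy (R : realType) (b : R) (rho : fop R) : R :=
  - complex.Re (optrace (op_fun (fun t => t * logb b t) rho)).

Definition is_dist (R : realType) (A : finType) (P : A -> R) : Prop :=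
  (forall a, 0 <= P a) /\ \sum_(a : A) P a = 1.

(* I(AB;Y) *)
Definition info_AB (R : realType) (b : R) (A B : finType)
    (W : A -> B -> fop R) (PA : A -> R) (PB : B -> R) : R :=
  vN_entropy b (fun m n =>
    \sum_(x : A) \sum_(y : B) (PA x * PB y)%:C * W x y m n)
  - \sum_(x : A) \sum_(y : B) PA x * PB y * vN_entropy b (W x y).

(* I(A;Y|B) *)
Definition info_A_given_B (R : realType) (b : R) (A B : finType)
    (W : A -> B -> fop R) (PA : A -> R) (PB : B -> R) : R :=
  \sum_(y : B) PB y *
    (vN_entropy b (fun m n => \sum_(x : A) (PA x)%:C * W x y m n)
     - \sum_(x : A) PA x * vN_entropy b (W x y)).

(* I(B;Y|A) *)
Definition info_B_given_A (R : realType) (b : R) (A B : finType)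
    (W : A -> B -> fop R) (PA : A -> R) (PB : B -> R) : R :=
  \sum_(x : A) PA x *
    (vN_entropy b (fun m n => \sum_(y : B) (PB y)%:C * W x y m n)
     - \sum_(y : B) PB y * vN_entropy b (W x y)).

(* The greatest element of S (0 if there is none). *)
Definition maximum (R : realType) (S : set R) : R :=
  xget 0 [set m | S m /\ ubound S m].

Definition coherent_mac (R : realType) (alpha : R[i]) : 'I_2 -> 'I_2 -> fop R :=
  fun x y =>
    let psi := coherent (((-1) ^+ x + (-1) ^+ y) * alpha) in ketbra psi psi.

Definition C_SD (R : realType) (b : R) (A B : finType)
    (W : A -> B -> fop R) : R :=
  maximum [set r | exists PA : A -> R, exists PB : B -> R,
    [/\ is_dist PA, is_dist PB &
        r = Num.min (info_A_given_B b W PA PB)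
              (Num.min (info_B_given_A b W PA PB)
                       (2^-1 * info_AB b W PA PB))]].

Definition I_max_infty (R : realType) (b : R) : R :=
  maximum [set r | exists PA : 'I_2 -> R, exists PB : 'I_2 -> R,
    [/\ is_dist PA, is_dist PB &
        r = eta b (PA ord0 * PB ord_max + PA ord_max * PB ord0)
            + eta b (PA ord0 * PB ord0)
            + eta b (PA ord_max * PB ord_max)]].

(* The filter |alpha| -> +oo on the complex plane. *)
Definition cinfty (R : realType) : set_system R[i] :=
  filter_from [set: R] (fun M => [set alpha | M < Normc.normc alpha]).
Arguments cinfty : clear implicits.

(* Main.v *)
(** Every output state in play is a mixture of the three coherent states of
    amplitudes 2 alpha, 0, -2 alpha with weights p, whose Gram matrix G has the
    entries x^((i-j)^2), with x = exp (-2 |alpha|^2).  As tr f(AB) = tr f(BA)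
    for polynomials f vanishing at 0, truncating the Fock space to N levels and
    letting N grow gives sum_k f(lam_k) = tr f(diag(p) G) for the spectrum lam
    of the mixture.  With - t ln t = sum_(n >= 1) t (1-t)^n / n, uniformly on [0, 1],
    the entropy is a uniform limit of polynomials in x and p; at x = 0, i.e. at
    |alpha| = oo, it is the Shannon entropy of p.  Hence the rate is uniformly
    continuous in x and in the input distributions: it has a maximum, and this
    maximum tends to the one at x = 0.  There, by Gibbs' inequality, replacing both
    Bernoulli inputs by their average increases the entropy of the sum, and for
    equal inputs the term I(AB;Y)/2 is the smallest of the three. *)

Require Import Defs.
From mathcomp Require Import all_boot all_order all_algebra.
From mathcomp Require Import complex.
From mathcomp Require Import all_classical all_reals all_analysis.
From mathcomp Require Import ring lra zify.
Import Order.TTheory GRing.Theory Num.Theory.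
Import numFieldNormedType.Exports.

Set Implicit Arguments.
Unset Strict Implicit.
Unset Printing Implicit Defensive.

Local Open Scope classical_set_scope.
Local Open Scope ring_scope.
Local Open Scope complex_scope.

(** * Componentwise limits of complex sequences and matrices *)

Section ComplexLimits.
Context {R : realType}.
Implicit Types (u v : nat -> R[i]) (l : R[i]).

(** Componentwise, to match [has_csum]; the matrix limits [mcvg] below are entrywise in the same
    way, so they pass through finite sums and products, hence through traces and determinants. *)
Definition ccvg u l : Prop :=
  (fun n => complex.Re (u n)) @ \oo --> complex.Re l /\
  (fun n => complex.Im (u n)) @ \oo --> complex.Im l.

Lemma ccvg_ext u v l : u =1 v -> ccvg u l -> ccvg v l.
Proof. by move=> /funext ->. Qed.

Lemma ccvg_cst l : ccvg (fun=> l) l.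
Proof. by split; exact: cvg_cst. Qed.

Lemma ccvgD u v (k l : R[i]) : ccvg u k -> ccvg v l -> ccvg (fun n => u n + v n) (k + l).
Proof.
move=> [ur ui] [vr vi]; split; rewrite raddfD.
  by under eq_fun do rewrite raddfD; exact: cvgD.
by under eq_fun do rewrite raddfD; exact: cvgD.
Qed.

Lemma ReM (k l : R[i]) : complex.Re (k * l) =
  complex.Re k * complex.Re l - complex.Im k * complex.Im l.
Proof. by case: k => a b; case: l => c d. Qed.

Lemma ImM (k l : R[i]) : complex.Im (k * l) =
  complex.Re k * complex.Im l + complex.Im k * complex.Re l.
Proof. by case: k => a b; case: l => c d. Qed.

Lemma ccvgM u v (k l : R[i]) : ccvg u k -> ccvg v l -> ccvg (fun n => u n * v n) (k * l).
Proof.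
move=> [ur ui] [vr vi]; split.
  rewrite ReM; under eq_fun do rewrite ReM.
  by apply: cvgB; apply: cvgM.
rewrite ImM; under eq_fun do rewrite ImM.
by apply: cvgD; apply: cvgM.
Qed.

Lemma ccvgN u l : ccvg u l -> ccvg (fun n => - u n) (- l).
Proof.
move=> [ur ui]; split; rewrite raddfN.
  by under eq_fun do rewrite raddfN; exact: cvgN.
by under eq_fun do rewrite raddfN; exact: cvgN.
Qed.

Lemma ccvg_sum (I : Type) (r : seq I) (P : pred I) (u : I -> nat -> R[i])
    (l : I -> R[i]) :
  (forall i, P i -> ccvg (u i) (l i)) ->
  ccvg (fun n => \sum_(i <- r | P i) u i n) (\sum_(i <- r | P i) l i).
Proof.
move=> ul; elim: r => [|i r ih].
  rewrite big_nil; apply: ccvg_ext (ccvg_cst _) => n; by rewrite big_nil.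
rewrite big_cons; case: ifPn => Pi.
  apply: ccvg_ext (ccvgD (ul i Pi) ih) => n; by rewrite big_cons Pi.
by apply: ccvg_ext ih => n; rewrite big_cons (negbTE Pi).
Qed.

Lemma ccvg_prod (I : Type) (r : seq I) (u : I -> nat -> R[i]) (l : I -> R[i]) :
  (forall i, ccvg (u i) (l i)) ->
  ccvg (fun n => \prod_(i <- r) u i n) (\prod_(i <- r) l i).
Proof.
move=> ul; elim: r => [|i r ih].
  rewrite big_nil; apply: ccvg_ext (ccvg_cst _) => n; by rewrite big_nil.
rewrite big_cons; apply: ccvg_ext (ccvgM (ul i) ih) => n; by rewrite big_cons.
Qed.

Lemma ccvg_unique u k l : ccvg u k -> ccvg u l -> k = l.
Proof.
move=> [kr ki] [lr li]; apply/eqP; rewrite eq_complex; apply/andP; split; apply/eqP.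
  exact: (cvg_unique _ kr lr).
exact: (cvg_unique _ ki li).
Qed.

Lemma ccvg_shift c u l : ccvg (fun n => u (n + c)%N) l -> ccvg u l.
Proof.
by move=> [ur ui]; split; [rewrite -(cvg_shiftn c)|rewrite -(cvg_shiftn c)].
Qed.

Definition mcvg m n (A : nat -> 'M[R[i]]_(m, n)) (L : 'M[R[i]]_(m, n)) :=
  forall i j, ccvg (fun N => A N i j) (L i j).

Lemma mcvg_ext m n (A B : nat -> 'M[R[i]]_(m, n)) L :
  A =1 B -> mcvg A L -> mcvg B L.
Proof. by move=> /funext ->. Qed.

Lemma mcvg_cst m n (L : 'M[R[i]]_(m, n)) : mcvg (fun=> L) L.
Proof. by move=> i j; exact: ccvg_cst. Qed.

Lemma mcvgB m n (A B : nat -> 'M[R[i]]_(m, n)) L K :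
  mcvg A L -> mcvg B K -> mcvg (fun N => A N - B N) (L - K).
Proof.
move=> AL BK i j; rewrite !mxE; apply: ccvg_ext (ccvgD (AL i j) (ccvgN (BK i j))) => N.
by rewrite !mxE.
Qed.

Lemma mcvgM m n p (A : nat -> 'M[R[i]]_(m, n)) (B : nat -> 'M[R[i]]_(n, p)) L K :
  mcvg A L -> mcvg B K -> mcvg (fun N => A N *m B N) (L *m K).
Proof.
move=> AL BK i j; rewrite !mxE.
suff h : ccvg (fun N => \sum_h A N i h * B N h j) (\sum_h L i h * K h j).
  by apply: ccvg_ext h => N; rewrite !mxE.
by apply: ccvg_sum => h _; apply: ccvgM; [exact: AL|exact: BK].
Qed.

Lemma mcvgX n (A : nat -> 'M[R[i]]_n) L k :
  mcvg A L -> mcvg (fun N => A N ^+ k) (L ^+ k).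
Proof.
move=> AL; elim: k => [|k ih]; first exact: mcvg_cst.
rewrite exprS; apply: mcvg_ext (mcvgM AL ih) => N; by rewrite exprS.
Qed.

Lemma ccvg_trace n (A : nat -> 'M[R[i]]_n) L :
  mcvg A L -> ccvg (fun N => \tr (A N)) (\tr L).
Proof. by move=> AL; apply: ccvg_sum => i _; exact: AL. Qed.

Lemma ccvg_det n (A : nat -> 'M[R[i]]_n) L :
  mcvg A L -> ccvg (fun N => \det (A N)) (\det L).
Proof.
move=> AL; apply: ccvg_sum => s _; apply: ccvgM; first exact: ccvg_cst.
by apply: ccvg_prod => i; exact: AL.
Qed.

(** Links series to truncated matrices: partial sums over ordinals are the entries of products of
    N-level matrices. *)
Lemma ccvg_has_csum u l : ccvg (fun N => \sum_(n < N) u n) l <-> has_csum u l.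
Proof.
rewrite /ccvg /has_csum !seriesEord.
have -> : (fun N => complex.Re (\sum_(n < N) u n)) =
    [sequence \sum_(k < n) complex.Re (u k)]_n.
  by apply/funext => N; rewrite raddf_sum.
have -> // : (fun N => complex.Im (\sum_(n < N) u n)) =
    [sequence \sum_(k < n) complex.Im (u k)]_n.
by apply/funext => N; rewrite raddf_sum.
Qed.

Lemma has_csum_csum u l : has_csum u l -> csum u = l.
Proof.
by case: l => a b [/= ur ui]; rewrite /csum (cvg_lim _ ur) ?(cvg_lim _ ui).
Qed.

Lemma has_csum_fin u N : (forall n, (N <= n)%N -> u n = 0) ->
  has_csum u (\sum_(n < N) u n).
Proof.
move=> u0; apply/ccvg_has_csum; apply: (@ccvg_shift N).
apply: ccvg_ext (ccvg_cst _) => n; rewrite -!(big_mkord xpredT).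
rewrite [RHS](big_cat_nat (n := N)) //= ?leq_addl // [X in _ = _ + X]big_nat_cond.
by rewrite [X in _ = _ + X]big1 ?addr0 // => i /andP[/andP[Ni _] _]; exact: u0.
Qed.

(** Both components of each term are at most |a n|^2 + |b n|^2 in absolute value, as the squares of
    sums and differences of coordinates are nonnegative; comparison gives absolute convergence. *)
Lemma square_summable_inner (a b : fvec R) : square_summable a ->
  square_summable b -> has_csum (fun n => conjc (a n) * b n) (inner a b).
Proof.
move=> sa sb.
have key (f : nat -> R) : (forall n, `|f n| <=
    Normc.normc (a n) ^+ 2 + Normc.normc (b n) ^+ 2) -> cvgn (series f).
  move=> fle; apply: normed_cvg.
  apply: (@series_le_cvg _ (fun n => `|f n|)
    (fun n => Normc.normc (a n) ^+ 2 + Normc.normc (b n) ^+ 2)) => //.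
  - by move=> n; rewrite addr_ge0 ?sqr_ge0.
  - exact: is_cvg_seriesD sa sb.
split; apply: key => n /=; case: (a n) => a1 a2; case: (b n) => b1 b2 /=.
all: rewrite !sqr_sqrtr ?addr_ge0 ?sqr_ge0 // ler_norml.
all: move: (sqr_ge0 (a1 - b1)) (sqr_ge0 (a1 + b1)) (sqr_ge0 (a2 - b2)) (sqr_ge0 (a2 + b2)).
all: move: (sqr_ge0 (a1 - b2)) (sqr_ge0 (a1 + b2)) (sqr_ge0 (a2 - b1)) (sqr_ge0 (a2 + b1)).
all: move: (sqr_ge0 a1) (sqr_ge0 a2) (sqr_ge0 b1) (sqr_ge0 b2).
all: rewrite !expr2 => *; apply/andP; split; lra.
Qed.

End ComplexLimits.

(** * Mixtures of pure states and their weighted Gram matrices *)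

Section Mixtures.
Context {R : realType}.

Definition adjmx m n (A : 'M[R[i]]_(m, n)) : 'M[R[i]]_(n, m) :=
  (map_mx (@conjc R) A)^T.

Definition trunc c (u : 'I_c -> fvec R) N : 'M[R[i]]_(N, c) :=
  \matrix_(n, k) u k n.

Definition gram c (u : 'I_c -> fvec R) : 'M[R[i]]_c :=
  \matrix_(i, j) inner (u i) (u j).

Definition cdiag c (p : 'I_c -> R) : 'M[R[i]]_c := diag_mx (\row_i (p i)%:C).

Definition mixture c (p : 'I_c -> R) (u : 'I_c -> fvec R) : fop R :=
  fun m n => \sum_i (p i)%:C * ketbra (u i) (u i) m n.

(** If V has the vectors as columns, the mixture is V diag(p) V^H; moving V to the end gives this
    finite matrix, which has the same nonzero spectrum. *)
Definition wgram c (p : 'I_c -> R) (u : 'I_c -> fvec R) : 'M[R[i]]_c :=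
  cdiag p *m gram u.

Lemma cvg_gram c (u : 'I_c -> fvec R) : (forall i, square_summable (u i)) ->
  mcvg (fun N => adjmx (trunc u N) *m trunc u N) (gram u).
Proof.
move=> su i j; rewrite mxE.
have /ccvg_has_csum := square_summable_inner (su i) (su j).
by apply: ccvg_ext => N; rewrite mxE; apply: eq_bigr => n _; rewrite !mxE.
Qed.

Lemma trunc_mixture c (p : 'I_c -> R) (u : 'I_c -> fvec R) N :
  \matrix_(m < N, n < N) mixture p u m n =
  trunc u N *m (cdiag p *m adjmx (trunc u N)).
Proof.
apply/matrixP => m n; rewrite !mxE /mixture; apply: eq_bigr => i _.
by rewrite mul_diag_mx !mxE /ketbra mulrCA.
Qed.

(** B (1 - AB)^k = (1 - BA)^k B, and the trace is cyclic. The leading factor AB matters: the trace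
    of (1 - AB)^k alone would see the size of the matrix. *)
Lemma mxtrace_mulC1B m n (A : 'M[R[i]]_(m, n)) (B : 'M[R[i]]_(n, m)) k :
  \tr ((A *m B) * (1 - A *m B) ^+ k) = \tr ((B *m A) * (1 - B *m A) ^+ k).
Proof.
have h : B *m (1 - A *m B) ^+ k = (1 - B *m A) ^+ k *m B.
  elim: k => [|k ih]; first by rewrite !expr0 mulmx1 mul1mx.
  rewrite exprS -[_ * _]/(_ *m _) mulmxA mulmxBr mulmx1 mulmxA.
  by rewrite -[X in X - _]mul1mx -mulmxBl -mulmxA ih mulmxA exprS.
rewrite -[_ * _]/(_ *m _) -mulmxA h mxtrace_mulC -mulmxA mxtrace_mulC.
by rewrite -[_ * _]/(_ *m _).
Qed.

(** On N levels, both sides become the trace of one polynomial in the same truncated operator.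
    Letting N grow turns the truncated Gram matrices into the full ones, and limits are unique. *)
Lemma mixture_wgram_trace c d (q : 'I_c -> R) (u : 'I_c -> fvec R)
    (p : 'I_d -> R) (v : 'I_d -> fvec R) k :
  (forall i, square_summable (u i)) -> (forall i, square_summable (v i)) ->
  (forall m n, mixture q u m n = mixture p v m n) ->
  \tr (wgram q u * (1 - wgram q u) ^+ k) = \tr (wgram p v * (1 - wgram p v) ^+ k).
Proof.
move=> su sv quv.
pose T c' (q' : 'I_c' -> R) (u' : 'I_c' -> fvec R) N : 'M[R[i]]_c' :=
  cdiag q' *m (adjmx (trunc u' N) *m trunc u' N).
have lim c' (q' : 'I_c' -> R) (u' : 'I_c' -> fvec R) :
    (forall i, square_summable (u' i)) ->
    ccvg (fun N => \tr (T c' q' u' N * (1 - T c' q' u' N) ^+ k))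
         (\tr (wgram q' u' * (1 - wgram q' u') ^+ k)).
  move=> su'; apply: ccvg_trace.
  have cT : mcvg (T c' q' u') (wgram q' u').
    by apply: mcvgM; [exact: mcvg_cst|exact: cvg_gram].
  apply: mcvgM (cT) _; apply: mcvgX; apply: mcvgB (cT); exact: mcvg_cst.
apply: ccvg_unique (lim _ _ _ su) _; apply: ccvg_ext (lim _ _ _ sv) => N.
rewrite /T !mulmxA -!(mxtrace_mulC1B (trunc _ N)) -!trunc_mixture.
suff -> : \matrix_(m < N, n < N) mixture p v m n = \matrix_(m, n) mixture q u m n by [].
by apply/matrixP => m n; rewrite !mxE quv.
Qed.

Lemma Re_mul_conjc (z : R[i]) :
  complex.Re (z * conjc z) = complex.Re z ^+ 2 + complex.Im z ^+ 2.
Proof. by case: z => a b /=; rewrite mulrN opprK !expr2. Qed.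

Lemma Re_realM (a : R) (z : R[i]) : complex.Re (a%:C * z) = a * complex.Re z.
Proof. by rewrite ReM /= mul0r subr0. Qed.

Lemma Re_sum (I : Type) (r : seq I) (P : pred I) (z : I -> R[i]) :
  complex.Re (\sum_(i <- r | P i) z i) = \sum_(i <- r | P i) complex.Re (z i).
Proof. exact: raddf_sum. Qed.

Lemma spectral_quadratic (rho : fop R) lam e N (x : 'I_N -> R[i]) :
  spectral_decomp rho lam e ->
  has_csum (fun k => (lam k)%:C *
      ((\sum_(m < N) x m * e k m) * conjc (\sum_(m < N) x m * e k m)))
    (\sum_(m < N) \sum_(n < N) x m * conjc (x n) * rho m n).
Proof.
case=> _ _ _ _ hrho; apply/ccvg_has_csum.
suff h : ccvg (fun K => \sum_(m < N) \sum_(n < N) x m * conjc (x n) *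
      \sum_(k < K) (lam k)%:C * ketbra (e k) (e k) m n)
    (\sum_(m < N) \sum_(n < N) x m * conjc (x n) * rho m n).
  apply: ccvg_ext h => K.
  under eq_bigr do under eq_bigr do rewrite mulr_sumr.
  under eq_bigr do rewrite exchange_big.
  rewrite exchange_big; apply: eq_bigr => k _.
  rewrite rmorph_sum mulr_suml mulr_sumr; apply: eq_bigr => m _.
  rewrite mulr_sumr mulr_sumr; apply: eq_bigr => n _.
  by rewrite /ketbra rmorphM /=; ring.
apply: ccvg_sum => m _; apply: ccvg_sum => n _.
by apply: ccvgM; [exact: ccvg_cst|have /ccvg_has_csum := hrho m n].
Qed.

(** The quadratic form of the mixture at x is a combination of the |x . v_i|^2, hence 0. By
    [spectral_quadratic] it is also the sum of the nonnegative terms lam_k |x . e_k|^2, so each of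
    these vanishes. *)
Lemma spectral_kernel d (p : 'I_d -> R) (v : 'I_d -> fvec R) lam e N
    (x : 'I_N -> R[i]) k :
  spectral_decomp (mixture p v) lam e -> lam k != 0 ->
  (forall i, \sum_(m < N) x m * v i m = 0) -> \sum_(m < N) x m * e k m = 0.
Proof.
move=> sp lk0 xv.
have [lam_ge0 _ _ _ _] := sp.
have [/= cre _] := spectral_quadratic x sp.
set t := fun k => complex.Re _ in cre.
have tE j : t j = lam j * (complex.Re (\sum_(m < N) x m * e j m) ^+ 2 +
    complex.Im (\sum_(m < N) x m * e j m) ^+ 2).
  by rewrite -Re_mul_conjc -Re_realM.
have t_ge0 j : 0 <= t j by rewrite tE mulr_ge0 ?addr_ge0 ?sqr_ge0.
have rho0 : \sum_(m < N) \sum_(n < N) x m * conjc (x n) * mixture p v m n = 0.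
  rewrite (_ : \sum_(m < N) _ = \sum_i (p i)%:C *
     ((\sum_(m < N) x m * v i m) * conjc (\sum_(m < N) x m * v i m))).
    by apply: big1 => i _; rewrite xv mul0r mulr0.
  under eq_bigr do under eq_bigr do rewrite mulr_sumr.
  under eq_bigr do rewrite exchange_big.
  rewrite exchange_big; apply: eq_bigr => i _.
  rewrite rmorph_sum mulr_suml mulr_sumr; apply: eq_bigr => m _.
  rewrite mulr_sumr mulr_sumr; apply: eq_bigr => n _.
  by rewrite /ketbra rmorphM /=; ring.
rewrite rho0 /= in cre.
have tk0 : t k <= 0.
  have <- : limn (series t) = 0 by exact: cvg_lim cre.
  apply: le_trans (_ : series t k.+1 <= _).
    by rewrite seriesEord /= big_ord_recr /= lerDr sumr_ge0.
  apply: nondecreasing_cvgn_le; last by apply/cvg_ex; exists 0.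
  by apply: nondecreasing_series => n _ _; exact: t_ge0.
have : t k == 0 by rewrite eq_le tk0 t_ge0.
rewrite tE mulf_eq0 (negbTE lk0) /= paddr_eq0 ?sqr_ge0 // !sqrf_eq0.
by move=> h; apply/eqP; rewrite eq_complex.
Qed.

(* The truncations of the e_k have rank at most d, so their Gram determinant is
   0 when c > d, whereas it tends to the determinant of the identity. *)
Lemma spectral_rank d (p : 'I_d -> R) (v : 'I_d -> fvec R) lam e c
    (f : 'I_c -> nat) :
  spectral_decomp (mixture p v) lam e -> injective f ->
  (forall i, lam (f i) != 0) -> (c <= d)%N.
Proof.
move=> sp finj lf; rewrite leqNgt; apply/negP => dc.
pose u i := e (f i).
have [_ _ sqe orth _] := sp.
have su i : square_summable (u i) by exact: sqe.
have g1 : gram u = 1.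
  apply/matrixP => i j; rewrite !mxE orth // (inj_eq finj).
  by case: (i == j).
have /ccvg_det := cvg_gram su; rewrite g1 det1 => h.
suff /(ccvg_unique h)/eqP : ccvg (fun N => \det (adjmx (trunc u N) *m trunc u N)) 0.
  by rewrite oner_eq0.
apply: ccvg_ext (ccvg_cst 0) => N; apply/esym/eqP; rewrite -[_ == 0]negbK -unitfE -unitmxE.
rewrite -row_free_unit -row_leq_rank -ltnNge.
apply: leq_ltn_trans (mxrankM_maxr _ _) _; apply: leq_ltn_trans dc.
apply: leq_trans (rank_leq_col (trunc v N)).
(* The left kernel of [trunc v N] has dimension at least N - d and annihilates [trunc u N], whose
   rank is therefore at most d. *)
have : kermx (trunc v N) *m trunc u N = 0.
  apply/matrixP => i j; rewrite [RHS]mxE mxE.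
  under eq_bigr => k _ do rewrite [trunc u N k j]mxE.
  apply: (spectral_kernel (x := fun k => kermx (trunc v N) i k) sp (lf j)) => i'.
  have /matrixP/(_ i i') := mulmx_ker (trunc v N); rewrite [in RHS]mxE mxE => h0.
  by rewrite -[RHS]h0; apply: eq_bigr => k _; rewrite [trunc v N k i']mxE.
move/mulmx0_rank_max; rewrite mxrank_ker => hr.
have := rank_leq_row (trunc v N); lia.
Qed.

End Mixtures.

(** * Existence of spectral decompositions *)

Section SpectralDecomposition.
Context {R : realType}.

Lemma conjcM (x y : R[i]) : conjc (x * y) = conjc x * conjc y.
Proof. exact: rmorphM. Qed.

Lemma normc_sqr (z : R[i]) : Normc.normc z ^+ 2 = complex.Re (conjc z * z).
Proof.
by case: z => a b /=; rewrite sqr_sqrtr ?addr_ge0 ?sqr_ge0 // mulNr opprK !expr2.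
Qed.

Lemma Im_conjc_mul (z : R[i]) : complex.Im (conjc z * z) = 0.
Proof. by case: z => a b /=; rewrite mulNr (mulrC b) subrr. Qed.

Lemma square_summableP (u : fvec R) l :
  has_csum (fun n => conjc (u n) * u n) l -> square_summable u.
Proof.
move=> [cr _]; apply/cvg_ex; exists (complex.Re l).
by under eq_fun do rewrite normc_sqr.
Qed.

Lemma square_summableZ (a : R[i]) (u : fvec R) :
  square_summable u -> square_summable (fun n => a * u n).
Proof.
move=> su; have /ccvg_has_csum h := square_summable_inner su su.
apply: (@square_summableP _ (conjc a * a * inner u u)); apply/ccvg_has_csum.
apply: ccvg_ext (ccvgM (ccvg_cst (conjc a * a)) h) => N.
by rewrite mulr_sumr; apply: eq_bigr => n _; rewrite conjcM mulrACA.
Qed.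

Lemma innerZ (a b : R[i]) (u v : fvec R) :
  square_summable u -> square_summable v ->
  inner (fun n => a * u n) (fun n => b * v n) = conjc a * b * inner u v.
Proof.
move=> su sv; have /ccvg_has_csum h := square_summable_inner su sv.
apply: has_csum_csum; apply/ccvg_has_csum.
apply: ccvg_ext (ccvgM (ccvg_cst (conjc a * b)) h) => N.
by rewrite mulr_sumr; apply: eq_bigr => n _; rewrite conjcM mulrACA.
Qed.

Lemma inner_conjc (u v : fvec R) : square_summable u -> square_summable v ->
  conjc (inner u v) = inner v u.
Proof.
move=> su sv; have /ccvg_has_csum [hr hi] := square_summable_inner su sv.
have /ccvg_has_csum h := square_summable_inner sv su.
apply: ccvg_unique h.
have E n : \sum_(i < n) conjc (v i) * u i = conjc (\sum_(i < n) conjc (u i) * v i).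
  by rewrite rmorph_sum; apply: eq_bigr => i _; rewrite /= conjcM conjcK mulrC.
split.
  under eq_fun do rewrite E; move: hr; case: (inner u v) => a b /= hr.
  suff -> : (fun n => complex.Re (conjc (\sum_(i < n) conjc (u i) * v i))) =
    fun n => complex.Re (\sum_(i < n) conjc (u i) * v i) by [].
  by apply/funext => n; case: (\sum_(_ < _) _).
under eq_fun do rewrite E; move: hi; case: (inner u v) => a b /= hi.
suff -> : (fun n => complex.Im (conjc (\sum_(i < n) conjc (u i) * v i))) =
  fun n => - complex.Im (\sum_(i < n) conjc (u i) * v i) by exact: cvgN.
by apply/funext => n; case: (\sum_(_ < _) _).
Qed.

Lemma inner_self (u : fvec R) : square_summable u ->
  [/\ complex.Im (inner u u) = 0, 0 <= complex.Re (inner u u) &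
      complex.Re (inner u u) = 0 -> forall n, u n = 0].
Proof.
move=> su; have [hr hi] := square_summable_inner su su.
pose t n := complex.Re (conjc (u n) * u n).
have t_ge0 n : 0 <= t n by rewrite /t -normc_sqr sqr_ge0.
have t_le n : t n <= complex.Re (inner u u).
  rewrite -(cvg_lim _ hr) //; apply: le_trans (_ : series t n.+1 <= _).
    by rewrite seriesEord /= big_ord_recr /= lerDr sumr_ge0.
  apply: nondecreasing_cvgn_le; last by apply/cvg_ex; exists (complex.Re (inner u u)).
  by apply: nondecreasing_series => k _ _; exact: t_ge0.
split.
- have: series (fun n => complex.Im (conjc (u n) * u n)) @ \oo --> (0 : R).
    rewrite seriesEord; suff -> : [sequence \sum_(k < n)
      complex.Im (conjc (u k) * u k)]_n = fun=> 0 by exact: cvg_cst.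
    by apply/funext => n; apply: big1 => k _; exact: Im_conjc_mul.
  exact: cvg_unique.
- exact: le_trans (t_ge0 0%N) (t_le 0%N).
- move=> u0 n; have : t n == 0 by rewrite eq_le t_ge0 -u0 t_le.
  rewrite /t -normc_sqr sqrf_eq0 => /eqP; exact: Normc.eq0_normc.
Qed.

Lemma adjmxM m n p (A : 'M[R[i]]_(m, n)) (B : 'M[R[i]]_(n, p)) :
  adjmx (A *m B) = adjmx B *m adjmx A.
Proof. by rewrite /adjmx map_mxM trmx_mul. Qed.

Lemma adjmxK m n (A : 'M[R[i]]_(m, n)) : adjmx (adjmx A) = A.
Proof. by apply/matrixP => i j; rewrite !mxE conjcK. Qed.

(** The spectral theorem for normal matrices, rephrased with [adjmx]. *)
Lemma unitary_diagonalization n (A : 'M[R[i]]_n) : adjmx A = A ->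
  exists P, exists D : 'rV_n, [/\ P *m adjmx P = 1, adjmx P *m P = 1 &
    P *m A *m adjmx P = diag_mx D].
Proof.
move=> Aself.
have adjE m p (B : 'M[R[i]]_(m, p)) : map_mx Num.conj (B^T) = adjmx B.
  by rewrite /adjmx map_trmx.
have An : A \is normalmx by apply/normalmxP; rewrite adjE Aself.
have /unitarymxP := spectral_unitarymx A; rewrite adjE => PP.
have := invmx_unitary (spectral_unitarymx A); rewrite adjE => Pinv.
exists (spectralmx A), (spectral_diag A).
have PP' : adjmx (spectralmx A) *m spectralmx A = 1 by exact: mulmx1C.
split=> //; rewrite {2}(orthomx_spectralP An) Pinv !mulmxA PP mul1mx.
by rewrite -mulmxA PP mulmx1.
Qed.

(** A singular value decomposition: with the weights absorbed into w_i = sqrt(p_i) v_i, a unitary P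
    diagonalising the Gram matrix of w recombines the w_i into orthogonal f_k. These have the same
    sum of projectors, and the nonzero ones are normalised. *)
Lemma mixture_spectral_decomp d (p : 'I_d -> R) (v : 'I_d -> fvec R) :
  (forall i, 0 <= p i) -> (forall i, square_summable (v i)) ->
  exists lam e, spectral_decomp (mixture p v) lam e.
Proof.
move=> p_ge0 sv.
pose w i : fvec R := fun n => (Num.sqrt (p i))%:C * v i n.
have sw i : square_summable (w i) by exact: square_summableZ.
have Gself : adjmx (gram w) = gram w.
  by apply/matrixP => i j; rewrite !mxE inner_conjc.
have [P [D [PP PP' PGP]]] := unitary_diagonalization Gself.
pose f k : fvec R := fun n => \sum_i conjc (P k i) * w i n.
have fE N : trunc f N = trunc w N *m adjmx P.
  by apply/matrixP => n k; rewrite !mxE; apply: eq_bigr => i _; rewrite !mxE mulrC.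
have cf : mcvg (fun N => adjmx (trunc f N) *m trunc f N) (diag_mx D).
  have : mcvg (fun N => P *m (adjmx (trunc w N) *m trunc w N) *m adjmx P) (diag_mx D).
    rewrite -PGP; apply: mcvgM; last exact: mcvg_cst.
    by apply: mcvgM; [exact: mcvg_cst|exact: cvg_gram].
  by apply: mcvg_ext => N; rewrite fE adjmxM adjmxK !mulmxA.
have hf j k : has_csum (fun n => conjc (f j n) * f k n) (diag_mx D j k).
  apply/ccvg_has_csum; apply: ccvg_ext (cf j k) => N.
  by rewrite mxE; apply: eq_bigr => n _; rewrite !mxE.
have sf k : square_summable (f k) by exact: square_summableP (hf k k).
have inf j k : inner (f j) (f k) = diag_mx D j k by exact: has_csum_csum.
pose mu k := complex.Re (inner (f k) (f k)).
have mu_ge0 k : 0 <= mu k by case: (inner_self (sf k)).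
have innE k : inner (f k) (f k) = (mu k)%:C.
  case: (inner_self (sf k)) => i0 _ _.
  by apply/eqP; rewrite eq_complex i0 /= !eqxx.
(* P cancels by unitarity, on a truncation long enough to contain both indices m and n. *)
have mixf m n : \sum_k f k m * conjc (f k n) = mixture p v m n.
  transitivity (\sum_i w i m * conjc (w i n)); last first.
    apply: eq_bigr => i _; rewrite /w /ketbra conjcM conjc_real.
    by rewrite mulrACA -rmorphM -expr2 sqr_sqrtr.
  have mn : (maxn m n < (maxn m n).+1)%N by [].
  have lm : (m < (maxn m n).+1)%N by rewrite ltnS leq_maxl.
  have ln : (n < (maxn m n).+1)%N by rewrite ltnS leq_maxr.
  have : trunc f (maxn m n).+1 *m adjmx (trunc f (maxn m n).+1) =
      trunc w (maxn m n).+1 *m adjmx (trunc w (maxn m n).+1).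
    by rewrite fE adjmxM adjmxK !mulmxA -[X in X *m _]mulmxA PP' mulmx1.
  move/matrixP/(_ (Ordinal lm) (Ordinal ln)).
  rewrite [LHS]mxE [RHS]mxE => h.
  transitivity (\sum_j trunc f (maxn m n).+1 (Ordinal lm) j *
        adjmx (trunc f (maxn m n).+1) j (Ordinal ln)).
    by apply: eq_bigr => k _; rewrite !mxE.
  by rewrite h; apply: eq_bigr => k _; rewrite !mxE.
(* The finite families are extended by zero to all of [nat]. *)
pose lam k : R := if insub k is Some i then mu i else 0.
pose e k : fvec R := if insub k is Some i
  then (fun n => ((Num.sqrt (mu i))^-1)%:C * f i n) else fun=> 0.
have mumu i : mu i != 0 -> ((Num.sqrt (mu i))^-1)%:C * ((Num.sqrt (mu i))^-1)%:C = ((mu i)^-1)%:C.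
  by move=> _; rewrite -rmorphM /= -expr2 exprVn sqr_sqrtr.
have lamE (k : 'I_d) : lam k = mu k by rewrite /lam valK.
have eE (k : 'I_d) : e k = fun n => ((Num.sqrt (mu k))^-1)%:C * f k n.
  by rewrite /e valK.
exists lam, e; split.
- by move=> k; rewrite /lam; case: insubP.
- apply/cvg_ex; exists (\sum_(k < d) complex.Re (lam k)%:C).
  have l0 k : (d <= k)%N -> (lam k)%:C = 0 :> R[i].
    by move=> dk; rewrite /lam insubN -?leqNgt.
  by have [] := has_csum_fin l0; rewrite raddf_sum.
- move=> k; rewrite /lam /e; case: insubP => [i _ _ _|_]; last by rewrite eqxx.
  exact: square_summableZ.
- move=> j k; rewrite /lam /e.
  case: insubP => [i _ <- mui|_]; last by rewrite eqxx.
  case: insubP => [i' _ <- mui'|_]; last by rewrite eqxx.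
  rewrite innerZ // conjc_real; case: eqVneq => [ii'|nii'].
    have ->: i = i' by exact: val_inj.
    by rewrite innE mumu // -rmorphM mulVf.
  rewrite inf mxE (_ : i == i' = false) ?mulr0n ?mulr0 //.
  by apply/negbTE; apply: contra nii' => /eqP ->.
- move=> m n; rewrite -mixf.
  have -> : \sum_k f k m * conjc (f k n) =
      \sum_(k < d) (lam k)%:C * ketbra (e k) (e k) m n.
    apply: eq_bigr => k _; rewrite lamE eE /ketbra conjcM conjc_real mulrACA.
    (* If [mu k] is 0, then [f k] is the zero vector and both sides vanish, although the normalising
       factor is then meaningless. *)
    have [mu0|mu0] := eqVneq (mu k) 0.
      by have [_ _ /(_ mu0) ->] := inner_self (sf k); rewrite !mul0r mulr0 mulr0.
    by rewrite mumu // [RHS]mulrA -[X in _ = X * _]rmorphM mulfV // mul1r.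
  apply: has_csum_fin => k dk.
  by rewrite /lam insubN -?leqNgt //= mul0r.
Qed.

End SpectralDecomposition.

(** * Polynomial approximation of the entropy *)

Section XlnxApproximation.
Context {R : realType}.

(** Partial sum of the series of - t ln t at t = 1, with n = k + 1. Every term keeps the factor t,
    as the trace identity for t (1 - t)^n requires. *)
Definition xlnx_poly (N : nat) (t : R) : R :=
  \sum_(k < N) t * (1 - t) ^+ k.+1 / k.+1%:R.

Definition ln_rest (N : nat) (x : R) : R :=
  - ln x - \sum_(k < N) (1 - x) ^+ k.+1 / k.+1%:R.

(** The derivatives of the terms form a geometric sum that telescopes against - 1/x. *)
Lemma is_derive_ln_rest N (x : R) : 0 < x ->
  is_derive x 1 (ln_rest N) (- (x^-1 * (1 - x) ^+ N)).
Proof.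
move=> x0; elim: N => [|N ih].
  have -> : ln_rest 0 = - @ln R.
    by apply/funext => y; rewrite /ln_rest big_ord0 subr0.
  by rewrite expr0 mulr1; apply: is_deriveN; exact: is_derive1_ln.
have -> : ln_rest N.+1 = ln_rest N - (N.+1%:R^-1 *: (fun y => (1 - y) ^+ N.+1)).
  apply/funext => y; rewrite /ln_rest big_ord_recr /= opprD addrA.
  by congr (_ - _); rewrite mulrC.
have dp : is_derive x 1 (fun y : R => (1 - y) ^+ N.+1) (- (N.+1%:R * (1 - x) ^+ N)).
  have d1 : is_derive x 1 (fun y : R => 1 - y) (- 1).
    have -> : (- 1 : R) = 0 - 1 by rewrite sub0r.
    by apply: is_deriveB; exact: is_derive_id.
  have -> : - (N.+1%:R * (1 - x) ^+ N) = (N.+1%:R * (1 - x) ^+ N) *: (- 1 : R).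
    by rewrite scalerN [_ *: 1]mulr1.
  have -> : (fun y : R => (1 - y) ^+ N.+1) = (fun y : R => 1 - y) ^+ N.+1.
    by rewrite exprfctE.
  exact: is_deriveX.
have -> : - (x^-1 * (1 - x) ^+ N.+1) = - (x^-1 * (1 - x) ^+ N) -
    N.+1%:R^-1 *: (- (N.+1%:R * (1 - x) ^+ N)).
  rewrite scalerN opprK [_ *: _]mulrA mulVf ?pnatr_eq0 // mul1r exprS.
  by field; rewrite gt_eqF.
by apply: is_deriveB; exact: is_deriveZ.
Qed.

Lemma nonincreasing_le1 (f df : R -> R) (t : R) : 0 < t <= 1 ->
  (forall x : R, 0 < x -> is_derive x 1 f (df x)) ->
  (forall x, 0 < x <= 1 -> df x <= 0) -> f 1 <= f t.
Proof.
move=> /andP[t0 t1] fdf df0.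
have pos x : t <= x -> 0 < x by exact: lt_le_trans.
apply: (@ler0_derive1_le_cc _ f t 1) => //; rewrite ?in_itv /= ?lexx ?t1 //.
- by move=> x; rewrite in_itv /= => /andP[/ltW/pos/fdf h _]; exact: ex_derive.
- move=> x; rewrite in_itv /= => /andP[/ltW/pos x0 /ltW x1].
  have h := fdf _ x0; rewrite derive1E derive_val; apply: df0; exact/andP.
- apply: derivable_within_continuous => x; rewrite in_itv /= => /andP[/pos/fdf h _].
  exact: ex_derive.
Qed.

(** The left side is the probability of at most one success in N + 1 independent trials of parameter
    x; the induction conditions on one further trial. *)
Lemma ler_mul_geometric N (x : R) : 0 <= x <= 1 ->
  N.+1%:R * x * (1 - x) ^+ N + (1 - x) ^+ N.+1 <= 1.
Proof.
move=> /andP[x0 x1]; have y0 : 0 <= 1 - x by rewrite subr_ge0.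
have y1 : 1 - x <= 1 by rewrite gerBl.
elim: N => [|N ih]; first by rewrite expr0 expr1; lra.
have yN : (1 - x) ^+ N.+1 <= 1 by rewrite exprn_ile1.
have -> : N.+2%:R * x * (1 - x) ^+ N.+1 + (1 - x) ^+ N.+2 =
  (1 - x) * (N.+1%:R * x * (1 - x) ^+ N + (1 - x) ^+ N.+1) + x * (1 - x) ^+ N.+1.
  by rewrite -(natr1 N.+1) !exprS; ring.
have := ler_wpM2l y0 ih; have := ler_wpM2l x0 yN; rewrite !mulr1; lra.
Qed.

(** The error is t times [ln_rest N t]. Both [ln_rest N] and 1/((N+1) x) - [ln_rest N] are
    nonincreasing on ]0, 1] and nonnegative at 1, which traps the error between 0 and 1/(N+1). At t
    = 0 both functions are 0. *)
Lemma xlnx_poly_approx N (t : R) : 0 <= t <= 1 ->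
  `| - (t * ln t) - xlnx_poly N t | <= N.+1%:R^-1.
Proof.
move=> /andP[]; rewrite le_eqVlt => /orP[/eqP <- _|t0 t1].
  rewrite mul0r oppr0 sub0r normrN /xlnx_poly big1 ?normr0 // => k _.
  by rewrite !mul0r.
have t01 : 0 < t <= 1 by rewrite t0.
have -> : - (t * ln t) - xlnx_poly N t = t * ln_rest N t.
  rewrite /xlnx_poly /ln_rest mulrBr mulrN mulr_sumr.
  by congr (_ - _); apply: eq_bigr => k _; rewrite mulrA.
have rest1 : ln_rest N 1 = 0.
  rewrite /ln_rest ln1 oppr0 sub0r big1 ?oppr0 // => k _.
  by rewrite subrr expr0n /= mul0r.
have rest_ge0 : 0 <= ln_rest N t.
  rewrite -rest1; apply: (@nonincreasing_le1 _ (fun x => - (x^-1 * (1 - x) ^+ N))) => //.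
    by move=> x x0; exact: is_derive_ln_rest.
  move=> x /andP[x0 x1]; rewrite oppr_le0 mulr_ge0 ?invr_ge0 ?(ltW x0) //.
  by rewrite exprn_ge0 // subr_ge0.
rewrite ger0_norm ?mulr_ge0 // ?(ltW t0) //.
(* Its derivative is ((N+1) x (1-x)^N - 1) / ((N+1) x^2), which is nonpositive by
   [ler_mul_geometric]. *)
pose h x := N.+1%:R^-1 * x^-1 - ln_rest N x.
have : h 1 <= h t.
  apply: (@nonincreasing_le1 _ (fun x => N.+1%:R^-1 * (- x ^- 2) -
     - (x^-1 * (1 - x) ^+ N))) => //.
    move=> x x0; apply: is_deriveB; last exact: is_derive_ln_rest.
    have dv : is_derive x 1 (fun y : R => y^-1) (- x ^- 2).
      have -> : - x ^- 2 = - x ^- 2 *: (1 : R) by rewrite [_ *: 1]mulr1.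
      by apply: (@is_deriveV _ id) => //; rewrite gt_eqF.
    exact: (is_deriveZ (N.+1%:R^-1) dv).
  move=> x /andP[x0 x1].
  have x01 : 0 <= x <= 1 by rewrite ltW.
  have := ler_mul_geometric N x01.
  have : 0 <= (1 - x) ^+ N.+1 by rewrite exprn_ge0 // subr_ge0.
  move=> a b; have c : N.+1%:R * x * (1 - x) ^+ N <= 1.
    by apply: le_trans b; rewrite lerDl.
  have -> : N.+1%:R^-1 * (- x ^- 2) - - (x^-1 * (1 - x) ^+ N) =
     (N.+1%:R * x * (1 - x) ^+ N - 1) * (N.+1%:R^-1 * x ^- 2).
    by field; rewrite (gt_eqF x0) addrC natr1 pnatr_eq0.
  by rewrite mulr_le0_ge0 ?subr_le0 // mulr_ge0 ?invr_ge0 ?ler0n ?sqr_ge0.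
rewrite /h rest1 invr1 mulr1 subr0 => h1.
have p : 0 <= N.+1%:R^-1 :> R by rewrite invr_ge0.
have : ln_rest N t <= N.+1%:R^-1 * t^-1.
  by rewrite -subr_ge0; exact: le_trans p h1.
move=> /(ler_wpM2l (ltW t0)) /le_trans; apply.
by rewrite mulrCA mulfV ?gt_eqF // mulr1.
Qed.

End XlnxApproximation.

(** * Entropies of mixtures as uniform limits of traces *)

Section EntropyApproximation.
Context {R : realType}.

(** By [spectral_rank], at most d of the lam_k with k < m are nonzero, for every m. At an M where
    this count is maximal, all later lam_k vanish, and [f] lists the nonzero ones. *)
Lemma spectral_finite d (p : 'I_d -> R) (v : 'I_d -> fvec R) lam e :
  spectral_decomp (mixture p v) lam e ->
  exists c, exists f : 'I_c -> nat, exists M, [/\ (c <= d)%N, injective f,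
    forall i, lam (f i) != 0, forall k, (M <= k)%N -> lam k = 0 &
    forall (V : nmodType) (g : nat -> V), (forall k, lam k = 0 -> g k = 0) ->
      \sum_(k < M) g k = \sum_i g (f i)].
Proof.
move=> sp.
pose s m := [seq k <- iota 0 m | lam k != 0].
have us m : uniq (s m) by rewrite filter_uniq ?iota_uniq.
have finj m : injective (fun i : 'I_(size (s m)) => nth 0%N (s m) i).
  move=> i j /eqP; rewrite nth_uniq // => /eqP; exact: val_inj.
have lf m (i : 'I_(size (s m))) : lam (nth 0%N (s m) i) != 0.
  by have := mem_nth 0%N (ltn_ord i); rewrite mem_filter => /andP[].
have sd m : (size (s m) <= d)%N by exact: spectral_rank sp (finj m) (lf m).
pose P n := `[< exists m, size (s m) = n >].
have exP : exists n, P n by exists (size (s 0%N)); apply/asboolP; exists 0%N.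
have leP n : P n -> (n <= d)%N by move=> /asboolP[m <-].
have [n /asboolP[M sM] maxn] := ex_maxnP exP leP.
have lam0 k : (M <= k)%N -> lam k = 0.
  move=> Mk; apply/eqP; apply: contraT => lk.
  have /maxn : P (size (s k.+1)) by apply/asboolP; exists k.+1.
  rewrite -sM /s -addn1 iotaD filter_cat size_cat /= add0n lk /=.
  have -> : k = (M + (k - M))%N by lia.
  by rewrite iotaD filter_cat size_cat /=; lia.
exists (size (s M)), (fun i => nth 0%N (s M) i), M; split=> //.
move=> V g g0; rewrite -(big_mkord xpredT g) /index_iota subn0.
rewrite (bigID (fun k => lam k != 0)) /= [X in _ + X]big1 ?addr0; last first.
  by move=> k /negPn/eqP; exact: g0.
by rewrite -big_filter -/(s M) (big_nth 0%N) big_mkord.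
Qed.

Lemma optrace_mixture c (q : 'I_c -> R) (u : 'I_c -> fvec R) :
  (forall i, square_summable (u i)) ->
  optrace (mixture q u) = \sum_i (q i)%:C * inner (u i) (u i).
Proof.
move=> su; apply: has_csum_csum; apply/ccvg_has_csum.
suff h : ccvg (fun N => \sum_i (q i)%:C * \sum_(n < N) conjc (u i n) * u i n)
    (\sum_i (q i)%:C * inner (u i) (u i)).
  apply: ccvg_ext h => N; rewrite exchange_big /=; apply: eq_bigr => i _.
  by rewrite mulr_sumr; apply: eq_bigr => n _; rewrite /ketbra [u i n * _]mulrC.
apply: ccvg_sum => i _; apply: ccvgM; first exact: ccvg_cst.
by have /ccvg_has_csum := square_summable_inner (su i) (su i).
Qed.

(** Existence ensures that [the_spectral_decomp] returns a genuine decomposition. Its nonzero part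
    is finite and orthonormal, so the entropy becomes a finite sum. *)
Lemma mixture_spectrum d (p : 'I_d -> R) (v : 'I_d -> fvec R) (b : R) :
  (forall i, 0 <= p i) -> (forall i, square_summable (v i)) ->
  exists c, exists q : 'I_c -> R, exists u : 'I_c -> fvec R,
  [/\ (c <= d)%N, forall i, 0 <= q i, forall i, square_summable (u i), gram u = 1 &
     (forall m n, mixture q u m n = mixture p v m n) /\
     vN_entropy b (mixture p v) = \sum_i eta b (q i)].
Proof.
move=> p_ge0 sv.
have [lam0 [e0 sp0]] := mixture_spectral_decomp p_ge0 sv.
rewrite /vN_entropy /op_fun.
have : spectral_decomp (mixture p v) (the_spectral_decomp (mixture p v)).1
   (the_spectral_decomp (mixture p v)).2.
  rewrite /the_spectral_decomp; case: xgetP => [y _ //|/(_ (lam0, e0))]; exact.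
case: (the_spectral_decomp _) => lam e; rewrite -[(lam, e).1]/lam -[(lam, e).2]/e => sp.
have [c [f [M [cd finj lf lam0' sumf]]]] := spectral_finite sp.
have [lam_ge0 _ sqe orth hrho] := sp.
(* Used twice: g = id recovers the mixture, g(t) = t log t the operator whose trace is taken. As g 0
   = 0, null eigenvalues drop out. *)
have csumf (g : R -> R) m n : g 0 = 0 ->
    has_csum (fun k => (g (lam k))%:C * ketbra (e k) (e k) m n)
      (mixture (g \o lam \o f) (e \o f) m n).
  move=> g0; rewrite /mixture -[X in has_csum _ X](sumf _
     (fun k => (g (lam k))%:C * ketbra (e k) (e k) m n)); last first.
    by move=> k ->; rewrite g0 mul0r.
  by apply: has_csum_fin => k Mk; rewrite lam0' // g0 mul0r.
have su i : square_summable (e (f i)) by exact: sqe.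
have g1 : gram (e \o f) = 1.
  apply/matrixP => i j; rewrite !mxE /= orth // (inj_eq finj).
  by case: (i == j).
exists c, (lam \o f), (e \o f); split=> //; first by move=> i /=.
split=> [m n|].
  have /has_csum_csum <- := hrho m n; apply/esym.
  exact: has_csum_csum (csumf id m n erefl).
transitivity (- complex.Re
    (optrace (mixture ((fun t => t * logb b t) \o lam \o f) (e \o f)))).
  congr (- complex.Re (optrace _)).
  apply/funext => m; apply/funext => n; apply: has_csum_csum.
  by apply: (csumf (fun t => t * logb b t)); rewrite mul0r.
rewrite optrace_mixture // Re_sum -sumrN; apply: eq_bigr => i _.
by rewrite -[(e \o f) i]/(e (f i)) orth // eqxx Re_realM mulr1 /eta mulNr.
Qed.

Lemma cdiag_trace c (q : 'I_c -> R) k :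
  \tr (cdiag q * (1 - cdiag q) ^+ k) = \sum_i (q i * (1 - q i) ^+ k)%:C.
Proof.
have -> : (1 - cdiag q) ^+ k = cdiag (fun i => (1 - q i) ^+ k).
  elim: k => [|k ih].
    by apply/matrixP => i j; rewrite expr0 !mxE expr0.
  rewrite exprS ih; apply/matrixP => i j.
  rewrite -[_ * _]/(_ *m _) mul_mx_diag !mxE.
  case: eqVneq => [->|_] /=; last by rewrite !mulr0n subr0 mul0r.
  by rewrite !mulr1n exprS -[1]/((1 : R)%:C) -rmorphB -rmorphM.
rewrite /mxtrace; apply: eq_bigr => i _.
by rewrite -[_ * _]/(_ *m _) mul_diag_mx !mxE eqxx mulr1n -rmorphM.
Qed.

(** The trace of [xlnx_poly N] at a matrix, in natural units; the factor 1 / ln b enters later. *)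
Definition trace_entropy (N : nat) c (M : 'M[R[i]]_c) : R :=
  \sum_(k < N) complex.Re (\tr (M * (1 - M) ^+ k.+1)) / k.+1%:R.

Lemma eq_trace_entropy N c d (M : 'M[R[i]]_c) (M' : 'M[R[i]]_d) :
  (forall k, \tr (M * (1 - M) ^+ k) = \tr (M' * (1 - M') ^+ k)) ->
  trace_entropy N M = trace_entropy N M'.
Proof. by move=> h; apply: eq_bigr => k _; rewrite h. Qed.

Lemma trace_entropy_cdiag N c (q : 'I_c -> R) :
  trace_entropy N (cdiag q) = \sum_i xlnx_poly N (q i).
Proof.
rewrite exchange_big; apply: eq_bigr => k _.
by rewrite cdiag_trace Re_sum mulr_suml.
Qed.

Lemma sum_eta_approx N c (q : 'I_c -> R) b : 1 < b ->
  (forall i, 0 <= q i <= 1) ->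
  `| \sum_i eta b (q i) - (\sum_i xlnx_poly N (q i)) / ln b | <=
     c%:R * N.+1%:R^-1 / ln b.
Proof.
move=> b1 q01; have lb : 0 < ln b by rewrite ln_gt0.
rewrite mulr_suml -sumrB.
apply: le_trans (ler_norm_sum _ _ _) _.
have -> : c%:R * N.+1%:R^-1 / ln b = \sum_(i < c) N.+1%:R^-1 / ln b.
  by rewrite sumr_const card_ord -mulrA mulr_natl.
apply: ler_sum => i _.
have -> : eta b (q i) - xlnx_poly N (q i) / ln b =
    (- (q i * ln (q i)) - xlnx_poly N (q i)) / ln b.
  by rewrite /eta /logb mulrBl mulNr mulNr mulrA.
rewrite normrM (gtr0_norm (x := (ln b)^-1)) ?invr_gt0 // ler_pM2r ?invr_gt0 //.
exact: xlnx_poly_approx.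
Qed.

(** For the orthonormal eigenvectors the weighted Gram matrix is diag(q), so [mixture_wgram_trace]
    carries the scalar approximation at the eigenvalues q over to [wgram p v]. *)
Lemma vN_entropy_approx N d (p : 'I_d -> R) (v : 'I_d -> fvec R) b : 1 < b ->
  (forall i, 0 <= p i) -> \sum_i p i = 1 -> (forall i, square_summable (v i)) ->
  (forall i, inner (v i) (v i) = 1) ->
  `| vN_entropy b (mixture p v) - trace_entropy N (wgram p v) / ln b | <=
     d%:R * N.+1%:R^-1 / ln b.
Proof.
move=> b1 p_ge0 p1 sv v1; have lb : 0 < ln b by rewrite ln_gt0.
have [c [q [u [cd q_ge0 su gu [quv ->]]]]] := mixture_spectrum b p_ge0 sv.
have wq : wgram q u = cdiag q by rewrite /wgram gu mulmx1.
have tr k := mixture_wgram_trace k su sv quv.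
rewrite wq in tr.
(* The trace identity at exponent 0 says that the eigenvalues sum to 1. Hence they lie in [0, 1],
   where the polynomial approximation holds. *)
have q1 : \sum_i q i = 1.
  have := tr 0%N; rewrite cdiag_trace expr0 mulr1.
  move=> /(congr1 (@complex.Re R)); rewrite !Re_sum => h.
  transitivity (\sum_i complex.Re (q i * (1 - q i) ^+ 0)%:C).
    by apply: eq_bigr => i _; rewrite expr0 mulr1.
  rewrite h -p1; apply: eq_bigr => i _.
  by rewrite /wgram /cdiag mul_diag_mx !mxE Re_realM v1 mulr1.
rewrite -(eq_trace_entropy _ tr) trace_entropy_cdiag.
apply: le_trans (sum_eta_approx _ b1 _) _.
  move=> i; rewrite q_ge0 -q1 (bigD1 i) //= lerDl sumr_ge0 // => j _.
by rewrite ler_pM2r ?invr_gt0 // ler_pM2r ?invr_gt0 ?ltr0n // ler_nat.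
Qed.

End EntropyApproximation.

(** * Overlaps of coherent states *)

Section CoherentStates.
Context {R : realType}.

Lemma has_csum_real (u : nat -> R) (l : R) :
  series u @ \oo --> l -> has_csum (fun n => (u n)%:C) l%:C.
Proof.
move=> ul; split=> /=; first exact: ul.
rewrite (_ : series _ = fun=> 0); first exact: cvg_cst.
by apply/funext => n; rewrite /series /= big1.
Qed.

Lemma eq_has_csum (u v : nat -> R[i]) l : u =1 v -> has_csum u l -> has_csum v l.
Proof. by move=> /funext ->. Qed.

(** The coefficients multiply to the exponential series at a c |alpha|^2, and with the two Gaussian
    prefactors this completes the square (a - c)^2. Amplitudes are real multiples of one alpha,
    which makes the overlap real. *)
Lemma coherent_has_csum (alpha : R[i]) (a c : R) :
  has_csum (fun n => conjc (coherent (a%:C * alpha) n) * coherent (c%:C * alpha) n)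
    (expR (- ((a - c) ^+ 2 * Normc.normc alpha ^+ 2 / 2)))%:C.
Proof.
set r : R := Normc.normc alpha ^+ 2.
have nsq (t : R) : Normc.normc (t%:C * alpha) ^+ 2 = t ^+ 2 * r.
  rewrite Normc.normcM exprMn; congr (_ * _).
  by rewrite /Normc.normc /= expr0n addr0 sqr_sqrtr ?sqr_ge0.
have zz : conjc alpha * alpha = r%:C.
  apply/eqP; rewrite eq_complex /=.
  by rewrite -normc_sqr -/r Im_conjc_mul !eqxx.
pose K := expR (- (a ^+ 2 * r / 2)) * expR (- (c ^+ 2 * r / 2)).
have termE n : conjc (coherent (a%:C * alpha) n) * coherent (c%:C * alpha) n =
    (K * exp_coeff (a * c * r) n)%:C.
  rewrite /coherent !nsq conjcM conjc_real /exp_coeff /=.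
  set E1 := expR _; set E2 := expR _.
  have -> : conjc ((a%:C * alpha) ^+ n / (Num.sqrt (n`!%:R : R))%:C) =
      (a%:C * conjc alpha) ^+ n / (Num.sqrt (n`!%:R : R))%:C.
    rewrite conjcM conjc_inv conjc_real; congr (_ / _).
    by rewrite -{2}(conjc_real a) -conjcM; exact: (rmorphXn (@conjc R)).
  have sq : (Num.sqrt (n`!%:R : R))%:C^-1 * (Num.sqrt (n`!%:R : R))%:C^-1 = (n`!%:R^-1)%:C.
    by rewrite -fmorphV -rmorphM -invfM -expr2 sqr_sqrtr.
  rewrite mulrACA -rmorphM [X in _ * X]mulrACA sq -exprMn mulrACA zz -!rmorphM.
  by rewrite -rmorphXn -!rmorphM.
have -> : expR (- ((a - c) ^+ 2 * r / 2)) = K * expR (a * c * r).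
  rewrite /K -!expRD; congr expR; by field.
apply: eq_has_csum (fun n => esym (termE n)) _; apply: has_csum_real.
have -> : series (fun n => K * exp_coeff (a * c * r) n) =
    fun n => K * series (exp_coeff (a * c * r)) n.
  by apply/funext => n; rewrite /series /= mulr_sumr.
apply: cvgMl_tmp; rewrite /expR; exact: is_cvg_series_exp_coeff.
Qed.

Lemma square_summable_coherent (alpha : R[i]) (a : R) :
  square_summable (coherent (a%:C * alpha)).
Proof. exact: square_summableP (coherent_has_csum alpha a a). Qed.

Lemma inner_coherent (alpha : R[i]) (a c : R) :
  inner (coherent (a%:C * alpha)) (coherent (c%:C * alpha)) =
    (expR (- ((a - c) ^+ 2 * Normc.normc alpha ^+ 2 / 2)))%:C.
Proof. exact: has_csum_csum (coherent_has_csum alpha a c). Qed.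

(** The index is the number of senders that transmit 1, giving amplitudes 2 alpha, 0 and -2
    alpha. *)
Definition mac_state (alpha : R[i]) (i : 'I_3) : fvec R :=
  coherent ((2 - 2 * i%:R)%:C * alpha).

Definition overlap (alpha : R[i]) : R := expR (- (2 * Normc.normc alpha ^+ 2)).

(** In truncated subtraction, [i - j + (j - i)] is |i - j|. *)
Definition overlap_mx (x : R) (p : 'I_3 -> R) : 'M[R]_3 :=
  \matrix_(i, j) (p i * x ^+ ((i - j + (j - i)) ^ 2)%N).

Lemma inner_mac_state alpha i j : inner (mac_state alpha i) (mac_state alpha j) =
  (overlap alpha ^+ ((i - j + (j - i)) ^ 2)%N)%:C.
Proof.
rewrite inner_coherent /overlap -expRM_natl; congr ((expR _)%:C).
have -> : ((i - j + (j - i)) ^ 2)%N%:R = (i%:R - j%:R) ^+ 2 :> R.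
  rewrite natrX; case: (leqP i j) => ij.
    by rewrite (eqP (ij : (i - j == 0)%N)) add0n natrB // -sqrrN opprB.
  by rewrite (eqP (ltnW ij : (j - i == 0)%N)) addn0 natrB // ltnW.
by field.
Qed.

Lemma wgram_mac_state alpha p :
  wgram p (mac_state alpha) = map_mx (real_complex R) (overlap_mx (overlap alpha) p).
Proof.
apply/matrixP => i j.
by rewrite /wgram /cdiag mul_diag_mx !mxE inner_mac_state -rmorphM.
Qed.

(** At x = 0 the states are orthogonal: 0^0 = 1 leaves exactly the diagonal. *)
Lemma cdiag_overlap_mx p : cdiag p = map_mx (real_complex R) (overlap_mx 0 p).
Proof.
apply/matrixP => i j; rewrite !mxE expr0n expn_eq0 andbT addn_eq0 !subn_eq0.
by rewrite -eqn_leq -[(i : nat) == j]/(i == j); case: eqVneq => [->|_] /=;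
  rewrite ?mulr1 ?mulr0.
Qed.

Definition real_trace_entropy (N : nat) (M : 'M[R]_3) : R :=
  \sum_(k < N) \tr (M * (1 - M) ^+ k.+1) / k.+1%:R.

Lemma trace_entropy_real N M :
  trace_entropy N (map_mx (real_complex R) M) = real_trace_entropy N M.
Proof.
apply: eq_bigr => k _; congr (_ / _).
set n := k.+1.
have -> : (1 - map_mx (real_complex R) M) ^+ n = map_mx (real_complex R) ((1 - M) ^+ n).
  rewrite rmorphXn; congr (_ ^+ _); rewrite rmorphB; congr (_ - _).
  by rewrite -[RHS]/(map_mx (real_complex R) 1) map_mx1.
by rewrite -[_ * map_mx _ _]/(_ *m _) -map_mxM trace_map_mx.
Qed.

End CoherentStates.

(** * Uniform limits of Lipschitz functions *)

Section UniformApproximation.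
Context {R : realType}.

(* [None] is the point at infinity of the alpha-plane. *)
Definition ov (z : option R[i]) : R := if z is Some alpha then overlap alpha else 0.

Lemma ov_itv z : 0 <= ov z <= 1.
Proof.
case: z => [a|] /=; last by rewrite lexx ler01.
by rewrite expR_ge0 expR_le1 oppr_le0 mulr_ge0 // sqr_ge0.
Qed.

(** A channel together with the probabilities of symbol 1 for A and for B. *)
Definition point : Type := (option R[i] * R * R)%type.
Implicit Types (f g : point -> R) (x y : point).

Definition in_cube x : Prop := (0 <= x.1.2 <= 1) /\ (0 <= x.2 <= 1).

(** Channels are compared through their overlap, so alpha approaches [None] as |alpha| grows. *)
Definition pdist x y : R :=
  `|ov x.1.1 - ov y.1.1| + `|x.1.2 - y.1.2| + `|x.2 - y.2|.

Lemma pdist_ge0 x y : 0 <= pdist x y.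
Proof. by rewrite !addr_ge0. Qed.

Lemma pdist_le3 x y : in_cube x -> in_cube y -> pdist x y <= 3.
Proof.
have h (a c : R) : 0 <= a <= 1 -> 0 <= c <= 1 -> `|a - c| <= 1.
  by move=> /andP[? ?] /andP[? ?]; rewrite ler_norml; apply/andP; split; lra.
move=> [x1 x2] [y1 y2].
have := h _ _ (ov_itv x.1.1) (ov_itv y.1.1); have := h _ _ x1 y1.
by have := h _ _ x2 y2; rewrite /pdist; lra.
Qed.

Definition lip f : Prop := exists2 C : R, 0 <= C &
  forall x y, in_cube x -> in_cube y -> `|f x - f y| <= C * pdist x y.

Lemma lip_bounded f : lip f -> exists2 K : R, 0 <= K &
  forall x, in_cube x -> `|f x| <= K.
Proof.
move=> [C C0 fC]; exists (`|f (None, 0, 0)| + C * 3); first by rewrite addr_ge0 ?mulr_ge0.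
have c0 : in_cube (None, 0, 0) by split; rewrite /= lexx ler01.
move=> x cx; rewrite -(subrK (f (None, 0, 0)) (f x)) addrC.
apply: le_trans (ler_normD _ _) _; rewrite lerD2l.
apply: le_trans (fC _ _ cx c0) _; apply: ler_wpM2l => //; exact: pdist_le3.
Qed.

Lemma eq_lip f g : f =1 g -> lip f -> lip g.
Proof. by move=> /funext ->. Qed.

Lemma lip_cst (c : R) : lip (fun=> c).
Proof. by exists 0 => // x y _ _; rewrite subrr normr0 mul0r. Qed.

Lemma lip_ov : lip (fun x => ov x.1.1).
Proof. by exists 1 => // x y _ _; rewrite mul1r /pdist -addrA lerDl addr_ge0. Qed.

Lemma lip_fst : lip (fun x => x.1.2).
Proof.
exists 1 => // x y _ _; rewrite mul1r /pdist.
by have := normr_ge0 (ov x.1.1 - ov y.1.1); have := normr_ge0 (x.2 - y.2); lra.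
Qed.

Lemma lip_snd : lip (fun x => x.2).
Proof. by exists 1 => // x y _ _; rewrite mul1r /pdist lerDr addr_ge0. Qed.

Lemma lipD f g : lip f -> lip g -> lip (fun x => f x + g x).
Proof.
move=> [C C0 fC] [D D0 gD]; exists (C + D); first exact: addr_ge0.
move=> x y cx cy; rewrite mulrDl opprD addrACA.
by apply: le_trans (ler_normD _ _) _; apply: lerD; [exact: fC|exact: gD].
Qed.

Lemma lipM f g : lip f -> lip g -> lip (fun x => f x * g x).
Proof.
move=> lf lg; have [K K0 fK] := lip_bounded lf; have [L L0 gL] := lip_bounded lg.
case: lf lg => [C C0 fC] [D D0 gD].
exists (K * D + L * C); first by rewrite addr_ge0 ?mulr_ge0.
move=> x y cx cy.
have -> : f x * g x - f y * g y = f x * (g x - g y) + g y * (f x - f y) by ring.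
rewrite mulrDl -!mulrA; apply: le_trans (ler_normD _ _) _; rewrite !normrM.
apply: lerD; apply: ler_pM => //; [exact: fK|exact: gD|exact: gL|exact: fC].
Qed.

Lemma lipB f g : lip f -> lip g -> lip (fun x => f x - g x).
Proof.
move=> lf lg; have := lipD lf (lipM (lip_cst (-1)) lg).
by under eq_fun do rewrite mulN1r.
Qed.

Lemma lip_sum n (f : 'I_n -> point -> R) : (forall i, lip (f i)) ->
  lip (fun x => \sum_i f i x).
Proof.
move=> lf; suff h (r : seq 'I_n) : lip (fun x => \sum_(i <- r) f i x) by exact: h.
elim: r => [|i r ih]; first by under eq_fun do rewrite big_nil; exact: lip_cst.
by under eq_fun do rewrite big_cons; exact: lipD.
Qed.

Lemma lipX f n : lip f -> lip (fun x => f x ^+ n).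
Proof.
move=> lf; elim: n => [|n ih]; first by under eq_fun do rewrite expr0; exact: lip_cst.
by under eq_fun do rewrite exprS; exact: lipM.
Qed.

Lemma lip_trace_entropy N (p : point -> 'I_3 -> R) :
  (forall i, lip (fun x => p x i)) ->
  lip (fun x => real_trace_entropy N (overlap_mx (ov x.1.1) (p x))).
Proof.
move=> lp.
pose mlip (A : point -> 'M[R]_3) := forall i j, lip (fun x => A x i j).
have mlipM A B : mlip A -> mlip B -> mlip (fun x => A x *m B x).
  move=> lA lB i j; under eq_fun do rewrite mxE.
  by apply: lip_sum => k; exact: lipM.
have lM : mlip (fun x => overlap_mx (ov x.1.1) (p x)).
  move=> i j; under eq_fun do rewrite mxE.
  by apply: lipM => //; apply: lipX; exact: lip_ov.
have lM1 : mlip (fun x => 1 - overlap_mx (ov x.1.1) (p x)).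
  move=> i j; apply: eq_lip (lipB (lip_cst ((1 : 'M[R]_3) i j)) (lM i j)) => x.
  by rewrite [RHS]mxE [X in _ = _ + X]mxE.
have lX k : mlip (fun x => (1 - overlap_mx (ov x.1.1) (p x)) ^+ k).
  elim: k => [|k ih].
    by under eq_fun do rewrite expr0; move=> i j; exact: lip_cst.
  by under eq_fun do rewrite exprS; exact: mlipM.
apply: lip_sum => k; apply: lipM; last exact: lip_cst.
by apply: lip_sum => i; exact: (mlipM _ _ lM (lX _)).
Qed.

(** Uniform limits of Lipschitz functions: the entropy is not itself Lipschitz, because - t log t
    has infinite slope at 0. *)
Definition uapprox f : Prop := forall e : R, 0 < e ->
  exists2 g, lip g & forall x, in_cube x -> `|f x - g x| <= e.

Lemma uapproxD f g : uapprox f -> uapprox g -> uapprox (fun x => f x + g x).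
Proof.
move=> uf ug e e0; have e2 : 0 < e / 2 by rewrite divr_gt0.
have [f' lf ff'] := uf _ e2; have [g' lg gg'] := ug _ e2.
exists (fun x => f' x + g' x); first exact: lipD.
move=> x cx; rewrite opprD addrACA (splitr e).
by apply: le_trans (ler_normD _ _) _; apply: lerD; [exact: ff'|exact: gg'].
Qed.

Lemma uapproxZ f g : lip f -> uapprox g -> uapprox (fun x => f x * g x).
Proof.
move=> lf ug e e0; have [K K0 fK] := lip_bounded lf.
have K1 : 0 < K + 1 by rewrite ltr_wpDl.
have [g' lg gg'] := ug _ (divr_gt0 e0 K1).
exists (fun x => f x * g' x); first exact: lipM.
move=> x cx; rewrite -mulrBr normrM.
apply: le_trans (_ : (K + 1) * (e / (K + 1)) <= _).
  apply: ler_pM => //; last exact: gg'.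
  by apply: le_trans (fK _ cx) _; rewrite lerDl.
by rewrite mulrC divfK // gt_eqF.
Qed.

Lemma min_dist (a a' c c' e : R) : `|a - a'| <= e -> `|c - c'| <= e ->
  `|Num.min a c - Num.min a' c'| <= e.
Proof.
rewrite !ler_norml => /andP[a1 a2] /andP[c1 c2].
by case: (leP a c) => h; case: (leP a' c') => h'; apply/andP; split; lra.
Qed.

Lemma uapprox_min f g : uapprox f -> uapprox g -> uapprox (fun x => Num.min (f x) (g x)).
Proof.
move=> uf ug e e0; have [f' lf ff'] := uf _ e0; have [g' lg gg'] := ug _ e0.
exists (fun x => Num.min (f' x) (g' x)).
  case: lf lg => [C C0 fC] [D D0 gD]; exists (C + D); first exact: addr_ge0.
  move=> x y cx cy; apply: min_dist.
    by apply: le_trans (fC _ _ cx cy) _; rewrite ler_wpM2r ?pdist_ge0 // lerDl.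
  by apply: le_trans (gD _ _ cx cy) _; rewrite ler_wpM2r ?pdist_ge0 // lerDr.
by move=> x cx; apply: min_dist; [exact: ff'|exact: gg'].
Qed.

Lemma uapprox_unif_continuous f : uapprox f -> forall e : R, 0 < e ->
  exists2 d : R, 0 < d & forall x y, in_cube x -> in_cube y -> pdist x y <= d ->
    `|f x - f y| <= e.
Proof.
move=> uf e e0; have e3 : 0 < e / 3 by rewrite divr_gt0.
have [g [C C0 gC] fg] := uf _ e3.
(* C may be 0; dividing by C + 1 avoids a case distinction. *)
have C1 : 0 < C + 1 by rewrite ltr_wpDl.
exists (e / 3 / (C + 1)); first exact: divr_gt0.
move=> x y cx cy xy.
have h : `|g x - g y| <= e / 3.
  apply: le_trans (gC _ _ cx cy) _.
  apply: le_trans (_ : (C + 1) * (e / 3 / (C + 1)) <= _).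
    by apply: ler_pM => //; rewrite ?pdist_ge0 // lerDl.
  by rewrite mulrC divfK // gt_eqF.
have := fg _ cx; have := fg _ cy; move: h.
rewrite !ler_norml => /andP[? ?] /andP[? ?] /andP[? ?]; apply/andP; split; lra.
Qed.

(** For a fixed channel, uniform continuity makes f continuous on the compact unit square, where the
    extreme value theorem applies. *)
Lemma uapprox_max f z : uapprox f -> exists s, exists t,
  in_cube (z, s, t) /\
  forall s' t', in_cube (z, s', t') -> f (z, s', t') <= f (z, s, t).
Proof.
move=> uf; pose A : set (R * R) := `[0, 1] `*` `[0, 1].
have AE st : A st <-> in_cube (z, st.1, st.2).
  by split; rewrite /A /in_cube /= !in_itv.
have cA : compact A by apply: compact_setX; exact: segment_compact.
have A0 : A !=set0 by exists (0, 0); apply/AE; split; rewrite /= lexx ler01.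
have cf : {within A, continuous (fun st : R * R => f (z, st.1, st.2))}.
  apply/subspace_continuousP => st /AE Ast; apply/cvgrPdist_le => e e0.
  have [d d0 fd] := uapprox_unif_continuous uf e0.
  have d2 : 0 < d / 2 by rewrite divr_gt0.
  near=> st'; apply: fd => //.
    by apply/AE; near: st'; exact: withinT.
  have [h1 h2] : ball st (d / 2) st' by near: st'; apply: cvg_within; exact: nbhsx_ballx.
  rewrite /pdist /= subrr normr0 add0r (splitr d).
  by apply: lerD; apply: ltW; [exact: h1|exact: h2].
have [[s t] /set_mem/AE cst max] := compact_EVT_max A0 cA cf.
exists s, t; split=> // s' t' c'.
by have := max (s', t'); apply; apply/mem_set/AE.
Unshelve. all: by end_near. Qed.

End UniformApproximation.

(** * The mutual informations of the channel *)

Section MacInformation.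
Context {R : realType} (b : R) (b1 : 1 < b).
Implicit Types (z : option R[i]) (s t : R) (p : 'I_3 -> R).

Local Notation point := (@point R).

(** For [None] the three states count as orthogonal, so the weights themselves are the spectrum. *)
Definition ent z p : R :=
  if z is Some alpha then vN_entropy b (mixture p (mac_state alpha))
  else \sum_i eta b (p i).

Lemma ln_b_gt0 : 0 < ln b. Proof. by rewrite ln_gt0. Qed.

Lemma mac_state_summable (alpha : R[i]) i : square_summable (mac_state alpha i).
Proof. exact: square_summable_coherent. Qed.

Lemma mac_state_unit (alpha : R[i]) i : inner (mac_state alpha i) (mac_state alpha i) = 1.
Proof. by rewrite inner_mac_state subnn expr0. Qed.

Lemma dist_le1 c (p : 'I_c -> R) : is_dist p -> forall i, 0 <= p i <= 1.
Proof.
move=> [p0 p1] i; rewrite p0 -p1 (bigD1 i) //= lerDl sumr_ge0 // => j _.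
Qed.

(** One polynomial and one bound serve all z, the point at infinity included; the passage to the
    limit rests on this uniformity. *)
Lemma ent_approx N z p : is_dist p ->
  `| ent z p - real_trace_entropy N (overlap_mx (ov z) p) / ln b | <=
     3%:R * N.+1%:R^-1 / ln b.
Proof.
move=> pd; have [p0 p1] := pd; rewrite /ent -trace_entropy_real.
case: z => [alpha|] /=.
  rewrite -wgram_mac_state; apply: vN_entropy_approx => //.
    exact: mac_state_summable.
  exact: mac_state_unit.
rewrite -cdiag_overlap_mx trace_entropy_cdiag.
exact: sum_eta_approx (dist_le1 pd).
Qed.

Lemma small_inv (C e : R) : 0 < e -> exists N : nat, C * N.+1%:R^-1 <= e.
Proof.
move=> e0; exists (Num.bound (`|C| / e)).
rewrite ler_pdivrMr ?ltr0n // mulrC -ler_pdivrMr //.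
apply: le_trans (_ : `|C| / e <= _).
  by rewrite ler_pM2r ?invr_gt0 // ler_norm.
apply: le_trans (ltW (archi_boundP _)) _; first by rewrite divr_ge0 // ltW.
by rewrite ler_nat.
Qed.

Lemma uapprox_ent (p : point -> 'I_3 -> R) :
  (forall i, lip (fun x => p x i)) -> (forall x, in_cube x -> is_dist (p x)) ->
  uapprox (fun x => ent x.1.1 (p x)).
Proof.
move=> lp pd e e0; have lb := ln_b_gt0.
have [N hN] := small_inv (3%:R / ln b) e0.
exists (fun x => real_trace_entropy N (overlap_mx (ov x.1.1) (p x)) / ln b).
  by apply: lipM; [exact: lip_trace_entropy|exact: lip_cst].
move=> x cx; apply: le_trans (ent_approx N _ (pd _ cx)) _.
by rewrite mulrAC.
Qed.

(** For a single unit vector the weighted Gram matrix is 1, so every approximating polynomial gives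
    0 and the entropy is below any positive number. *)
Lemma pure_entropy (psi : fvec R) : square_summable psi -> inner psi psi = 1 ->
  vN_entropy b (ketbra psi psi) = 0.
Proof.
move=> spsi upsi; have lb := ln_b_gt0.
pose p (_ : 'I_1) : R := 1; pose v (_ : 'I_1) := psi.
have E : ketbra psi psi = mixture p v.
  apply/funext => m; apply/funext => n.
  by rewrite /mixture big_ord1 /p mul1r.
have g1 : wgram p v = cdiag p.
  apply/matrixP => i j; rewrite /wgram /cdiag mul_diag_mx !mxE !ord1 upsi.
  by rewrite eqxx mulr1.
have T0 N : trace_entropy N (wgram p v) = 0.
  rewrite g1 trace_entropy_cdiag big_ord1 /xlnx_poly big1 // => k _.
  by rewrite /p subrr expr0n /= mulr0 mul0r.
apply/eqP; rewrite -normr_le0 E; apply/ler_addgt0Pr => e e0; rewrite add0r.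
have [N hN] := small_inv (1%:R / ln b) e0.
have := @vN_entropy_approx R N 1 p v b b1; rewrite T0 mul0r subr0.
move=> /(_ _ _ _ _)/le_trans; apply => //; last by rewrite mulrAC.
by rewrite big_ord1.
Qed.

Definition p3 (a c d : R) : 'I_3 -> R := fun i => nth 0 [:: a; c; d] i.

Lemma p3_dist a c d : 0 <= a -> 0 <= c -> 0 <= d -> a + c + d = 1 ->
  is_dist (p3 a c d).
Proof.
move=> a0 c0 d0 e1; split; first by case=> -[|[|[|]]].
by rewrite !big_ord_recr big_ord0 /= add0r.
Qed.

Lemma lip_p3 (f g h : point -> R) : lip f -> lip g -> lip h ->
  forall i, lip (fun x => p3 (f x) (g x) (h x) i).
Proof. by move=> lf lg lh [[|[|[|]]]]. Qed.

(** I(AB;Y): the outputs are pure, so only the entropy of the mixture remains, weighted by the law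
    of A + B. *)
Definition sum_info z s t : R :=
  ent z (p3 ((1 - s) * (1 - t)) ((1 - s) * t + s * (1 - t)) (s * t)).

(** I(A;Y|B): the output is state 0 or 1 when B = 0, and state 1 or 2 when B = 1. Exchanging s and t
    gives I(B;Y|A). *)
Definition cond_info z s t : R :=
  (1 - t) * ent z (p3 (1 - s) s 0) + t * ent z (p3 0 (1 - s) s).

Definition rate (x : point) : R :=
  Num.min (cond_info x.1.1 x.1.2 x.2)
    (Num.min (cond_info x.1.1 x.2 x.1.2) (2^-1 * sum_info x.1.1 x.1.2 x.2)).

Lemma uapprox_rate : uapprox rate.
Proof.
have l1 := lip_cst (1 : R); have l0 := lip_cst (0 : R).
have ls := @lip_fst R; have lt := @lip_snd R.
have ls' := lipB l1 ls; have lt' := lipB l1 lt.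
have cond (f g : point -> R) : lip f -> lip g ->
    (forall x, in_cube x -> 0 <= f x <= 1) ->
    uapprox (fun x => cond_info x.1.1 (f x) (g x)).
  move=> lf lg f01; apply: uapproxD; apply: uapproxZ => //; try exact: lipB.
  - apply: uapprox_ent; first by apply: lip_p3 => //; exact: lipB.
    by move=> x /f01/andP[? ?]; apply: p3_dist; lra.
  - apply: uapprox_ent; first by apply: lip_p3 => //; exact: lipB.
    by move=> x /f01/andP[? ?]; apply: p3_dist; lra.
apply: uapprox_min; first by apply: cond => // x [].
apply: uapprox_min; first by apply: cond => // x [].
apply: uapproxZ; first exact: lip_cst.
apply: uapprox_ent.
  by apply: lip_p3; [exact: lipM|apply: lipD; exact: lipM|exact: lipM].
move=> x [/andP[s0 s1] /andP[t0 t1]].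
have s0' : 0 <= 1 - x.1.2 by lra.
have t0' : 0 <= 1 - x.2 by lra.
by apply: p3_dist; rewrite ?addr_ge0 ?mulr_ge0 //; ring.
Qed.

(** For bits, (-1)^w = 1 - 2 w, so the amplitude depends only on x + y. *)
Lemma coherent_macE (alpha : R[i]) (x y : 'I_2) : coherent_mac alpha x y =
  ketbra (mac_state alpha (inord (x + y))) (mac_state alpha (inord (x + y))).
Proof.
rewrite /coherent_mac /mac_state inordK; last by case: x => -[|[|]] //; case: y => -[|[|]].
suff -> : (-1) ^+ x + (-1) ^+ y = (2 - 2 * (x + y)%:R)%:C :> R[i] by [].
have sgn (w : 'I_2) : (-1) ^+ w = (1 - 2 * w%:R)%:C :> R[i].
  case: w => -[|[|//]] _ /=; apply/eqP; rewrite eq_complex ?expr0 ?expr1 /= ?oppr0 eqxx andbT; apply/eqP; ring.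
by rewrite !sgn -rmorphD natrD; congr (_%:C); ring.
Qed.

Lemma mac_pure_entropy (alpha : R[i]) x y : vN_entropy b (coherent_mac alpha x y) = 0.
Proof.
by rewrite coherent_macE pure_entropy ?mac_state_unit //; exact: mac_state_summable.
Qed.

Lemma sum3E (V : nmodType) (F : 'I_3 -> V) :
  \sum_i F i = F (inord 0) + F (inord 1) + F (inord 2).
Proof.
rewrite !big_ord_recr big_ord0 /= add0r.
by congr (F _ + F _ + F _); apply: val_inj; rewrite /= inordK.
Qed.

Lemma mixture_p3 (alpha : R[i]) a c d m n :
  mixture (p3 a c d) (mac_state alpha) m n =
  a%:C * ketbra (mac_state alpha (inord 0)) (mac_state alpha (inord 0)) m n +
  c%:C * ketbra (mac_state alpha (inord 1)) (mac_state alpha (inord 1)) m n +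
  d%:C * ketbra (mac_state alpha (inord 2)) (mac_state alpha (inord 2)) m n.
Proof. by rewrite /mixture sum3E /p3 !inordK. Qed.

Lemma dist2 (P : 'I_2 -> R) : is_dist P ->
  P ord0 = 1 - P ord_max /\ 0 <= P ord_max <= 1.
Proof.
move=> Pd; split; last exact: dist_le1.
by case: Pd => _; rewrite big_ord_recl big_ord1 (_ : lift _ _ = ord_max) => [<-|];
  [rewrite addrK|exact: val_inj].
Qed.

Lemma sum2E (V : nmodType) (F : 'I_2 -> V) : \sum_i F i = F ord0 + F ord_max.
Proof. by rewrite big_ord_recl big_ord1 (_ : lift _ _ = ord_max) //; exact: val_inj. Qed.

Lemma info_ABE (alpha : R[i]) PA PB : is_dist PA -> is_dist PB ->
  info_AB b (coherent_mac alpha) PA PB =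
  sum_info (Some alpha) (PA ord_max) (PB ord_max).
Proof.
move=> /dist2[A0 _] /dist2[B0 _]; rewrite /info_AB /sum_info /ent.
rewrite [X in _ - X]big1 ?subr0; last first.
  by move=> x _; rewrite big1 // => y _; rewrite mac_pure_entropy mulr0.
congr (vN_entropy b _); apply/funext => m; apply/funext => n.
rewrite mixture_p3 !sum2E !coherent_macE A0 B0.
by rewrite (rmorphD (real_complex R)) [X in _ = _ + X + _]mulrDl /= !addrA.
Qed.

Lemma info_A_given_BE (alpha : R[i]) PA PB : is_dist PA -> is_dist PB ->
  info_A_given_B b (coherent_mac alpha) PA PB =
  cond_info (Some alpha) (PA ord_max) (PB ord_max).
Proof.
move=> /dist2[A0 _] /dist2[B0 _]; rewrite /info_A_given_B /cond_info /ent sum2E B0.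
congr (_ * _ + _ * _).
  rewrite [X in _ - X]big1 ?subr0; last by move=> x _; rewrite mac_pure_entropy mulr0.
  congr (vN_entropy b _); apply/funext => m; apply/funext => n.
  by rewrite mixture_p3 !sum2E !coherent_macE A0 /= mul0r addr0.
rewrite [X in _ - X]big1 ?subr0; last by move=> x _; rewrite mac_pure_entropy mulr0.
congr (vN_entropy b _); apply/funext => m; apply/funext => n.
by rewrite mixture_p3 !sum2E !coherent_macE A0 /= mul0r add0r.
Qed.

Lemma info_B_given_AE (alpha : R[i]) PA PB : is_dist PA -> is_dist PB ->
  info_B_given_A b (coherent_mac alpha) PA PB =
  cond_info (Some alpha) (PB ord_max) (PA ord_max).
Proof.
move=> /dist2[A0 _] /dist2[B0 _]; rewrite /info_B_given_A /cond_info /ent sum2E A0.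
congr (_ * _ + _ * _).
  rewrite [X in _ - X]big1 ?subr0; last by move=> x _; rewrite mac_pure_entropy mulr0.
  congr (vN_entropy b _); apply/funext => m; apply/funext => n.
  by rewrite mixture_p3 !sum2E !coherent_macE B0 /= mul0r addr0.
rewrite [X in _ - X]big1 ?subr0; last by move=> x _; rewrite mac_pure_entropy mulr0.
congr (vN_entropy b _); apply/funext => m; apply/funext => n.
by rewrite mixture_p3 !sum2E !coherent_macE B0 /= mul0r add0r.
Qed.

End MacInformation.

(** * The limiting channel *)

Section NoiselessOptimum.
Context {R : realType} (b : R) (b1 : 1 < b).
Implicit Types s t q : R.

Lemma eta0 : eta b 0 = 0. Proof. by rewrite /eta oppr0 mul0r. Qed.

Lemma eta1 : eta b 1 = 0. Proof. by rewrite /eta /logb ln1 mul0r mulr0. Qed.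

Lemma eta_ge0 t : 0 <= t <= 1 -> 0 <= eta b t.
Proof.
move=> /andP[t0 t1]; rewrite /eta /logb mulNr -mulrN -mulNr mulr_ge0 //.
by rewrite mulr_ge0 ?invr_ge0 ?(ltW (ln_b_gt0 b1)) // oppr_ge0 ln_le0.
Qed.

Lemma logb2_ge0 : 0 <= logb b 2.
Proof. by rewrite divr_ge0 ?(ltW (ln_b_gt0 b1)) // ln_ge0 // ler1n. Qed.

(** One term of Gibbs' inequality, from ln(1 + u) <= u at u = q/t - 1. Summed over two
    distributions, the corrections (q - t) / ln b cancel. *)
Lemma gibbs1 t q : 0 <= t -> 0 < q ->
  eta b t <= - t * logb b q + (q - t) / ln b.
Proof.
move=> t0 q0; have lb := ln_b_gt0 b1.
rewrite /eta /logb !mulrA -mulrDl ler_pM2r ?invr_gt0 //.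
move: t0; rewrite le_eqVlt => /orP[/eqP <-|t0].
  by rewrite oppr0 !mul0r add0r addr0 ltW.
have : ln (1 + (q / t - 1)) <= q / t - 1.
  by apply: le_ln1Dx; rewrite ltrBrDl subrr divr_gt0.
rewrite addrC subrK ln_div ?posrE //.
move=> /(ler_wpM2l (ltW t0)); rewrite !mulrBr mulr1 mulrCA mulfV ?gt_eqF // mulr1; lra.
Qed.

Lemma sum_infoE s t : sum_info b None s t =
  eta b ((1 - s) * (1 - t)) + eta b ((1 - s) * t + s * (1 - t)) + eta b (s * t).
Proof. by rewrite /sum_info /ent !big_ord_recr big_ord0 /= add0r. Qed.

Lemma cond_infoE s t : cond_info b None s t = eta b (1 - s) + eta b s.
Proof.
rewrite /cond_info /ent !big_ord_recr !big_ord0 /p3 /= add0r eta0.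
by ring.
Qed.

(* The law of A + B, for A and B independent Bernoulli of parameters s and t,
   is compared with the binomial law of the same mean. *)
Lemma sum_info_cross s t q : 0 <= s <= 1 -> 0 <= t <= 1 -> 0 < q < 1 ->
  s + t = 2 * q ->
  sum_info b None s t <= 2 * (eta b (1 - q) + eta b q)
    - ((1 - s) * t + s * (1 - t)) * logb b 2.
Proof.
move=> /andP[s0 s1] /andP[t0 t1] /andP[q0 q1] stq; rewrite sum_infoE.
have s0' : 0 <= 1 - s by lra.
have t0' : 0 <= 1 - t by lra.
have q0' : 0 < 1 - q by lra.
have h0 := gibbs1 (mulr_ge0 s0' t0') (mulr_gt0 q0' q0').
have q2 : 0 < 2 * (q * (1 - q)) by rewrite !mulr_gt0.
have h1 := gibbs1 (addr_ge0 (mulr_ge0 s0' t0) (mulr_ge0 s0 t0')) q2.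
have h2 := gibbs1 (mulr_ge0 s0 t0) (mulr_gt0 q0 q0).
apply: le_trans (lerD (lerD h0 h1) h2) _.
(* Equality holds here: up to a log 2 at the middle point, the logarithms of the binomial weights
   are affine in the value of A + B, so the cross entropy depends only on the mean 2 q and on the
   probability that A + B = 1. *)
rewrite le_eqVlt; apply/orP; left; apply/eqP.
rewrite /logb /eta /logb !lnM ?posrE ?mulr_gt0 //.
have -> : t = 2 * q - s by rewrite -stq; ring.
by ring.
Qed.

Lemma sum_info_diag q : 0 < q < 1 ->
  sum_info b None q q = 2 * (eta b (1 - q) + eta b q) - 2 * (q * (1 - q)) * logb b 2.
Proof.
move=> /andP[q0 q1]; rewrite sum_infoE; have q0' : 0 < 1 - q by lra.
have -> : (1 - q) * q + q * (1 - q) = 2 * (q * (1 - q)) by ring.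
rewrite /logb /eta /logb !lnM ?posrE ?mulr_gt0 //.
by ring.
Qed.

(** The bound of [sum_info_cross] is attained at s = t = q, up to the probability that A + B = 1,
    which enters with a minus sign. That probability is at least 2 q (1 - q), because (s - t)^2 >=
    0. *)
Lemma sum_info_le_diag s t : 0 <= s <= 1 -> 0 <= t <= 1 ->
  sum_info b None s t <= sum_info b None ((s + t) / 2) ((s + t) / 2).
Proof.
move=> s01 t01; set q := (s + t) / 2.
have stq : s + t = 2 * q by rewrite /q; field.
clearbody q.
have [/andP[s0 s1] /andP[t0 t1]] := (s01, t01).
(* At q = 0 or q = 1 the binomial weights are not all positive, but then s = t = q is forced. *)
have [q0|q0] := eqVneq q 0.
  have e1 : s = q by lra.
  have e2 : t = q by lra.
  by rewrite e1 e2.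
have [q1|q1] := eqVneq q 1.
  have e1 : s = q by lra.
  have e2 : t = q by lra.
  by rewrite e1 e2.
have q01 : 0 < q < 1 by rewrite !lt_neqAle eq_sym q0 q1 /=; apply/andP; split; lra.
apply: le_trans (sum_info_cross s01 t01 q01 stq) _.
rewrite sum_info_diag // lerD2l lerN2 ler_wpM2r //.
  exact: logb2_ge0.
have := sqr_ge0 (s - t); rewrite (_ : t = 2 * q - s); last by rewrite -stq; ring.
by rewrite expr2; lra.
Qed.

(** For interior q, half of [sum_info_diag] is the binary entropy minus q (1 - q) log 2. *)
Lemma sum_info_diag_le q : 0 <= q <= 1 ->
  2^-1 * sum_info b None q q <= eta b (1 - q) + eta b q.
Proof.
move=> /andP[q0 q1].
have h : 0 <= eta b (1 - q) + eta b q by rewrite addr_ge0 // eta_ge0 //; lra.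
have [q00|q00] := eqVneq q 0.
  by rewrite sum_infoE q00 !subr0 !mulr0 !mulr1 !addr0 eta0 eta1; lra.
have [q11|q11] := eqVneq q 1.
  by rewrite sum_infoE q11 !subrr !mulr0 !mul0r !mulr1 !addr0 eta0 eta1; lra.
have q01 : 0 < q < 1 by rewrite !lt_neqAle eq_sym q00 q11 /=; exact/andP.
rewrite sum_info_diag //.
have : 0 <= q * (1 - q) * logb b 2.
  by apply: mulr_ge0 logb2_ge0; apply: mulr_ge0 => //; rewrite subr_ge0.
lra.
Qed.

Lemma rate_diag q : 0 <= q <= 1 ->
  rate b (None, q, q) = 2^-1 * sum_info b None q q.
Proof.
move=> q01; rewrite /rate /= !cond_infoE.
by rewrite !(min_r (sum_info_diag_le q01)).
Qed.

Lemma rate_le_sum_info x : rate b x <= 2^-1 * sum_info b x.1.1 x.1.2 x.2.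
Proof. by rewrite /rate !ge_min lexx !orbT. Qed.

End NoiselessOptimum.

(** * Attained maxima and the limit of large amplitude *)

Section Maxima.
Context {R : realType} (b : R) (b1 : 1 < b).

Lemma maximumE (S : set R) m : S m -> ubound S m -> maximum S = m.
Proof.
move=> Sm um; rewrite /maximum; case: xgetP => [y _ [Sy uy]|/(_ m)].
  by apply/eqP; rewrite eq_le um //= uy.
by case.
Qed.

Definition bernoulli (s : R) : 'I_2 -> R := fun i => if i == ord_max then s else 1 - s.

Lemma bernoulli_dist s : 0 <= s <= 1 -> is_dist (bernoulli s).
Proof.
move=> /andP[s0 s1]; split.
  by move=> i; rewrite /bernoulli; case: ifP => // _; rewrite subr_ge0.
by rewrite sum2E /bernoulli /= subrK.
Qed.

(** For two functions within e of each other with maxima [u] and [v]: [u'] is the first function at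
    the maximiser of the second, [v'] the second at the maximiser of the first. *)
Lemma dist_maxima (u v u' v' e : R) : `|u - v'| <= e -> `|u' - v| <= e ->
  u' <= u -> v' <= v -> `|u - v| <= e.
Proof.
rewrite !ler_norml => /andP[? ?] /andP[? ?] ? ?; apply/andP; split; lra.
Qed.

Lemma C_SD_rate (alpha : R[i]) s t : in_cube (Some alpha, s, t) ->
  (forall s' t', in_cube (Some alpha, s', t') ->
    rate b (Some alpha, s', t') <= rate b (Some alpha, s, t)) ->
  C_SD b (coherent_mac alpha) = rate b (Some alpha, s, t).
Proof.
move=> [/= s01 t01] maxst.
have rateE PA PB : is_dist PA -> is_dist PB ->
    Num.min (info_A_given_B b (coherent_mac alpha) PA PB)
      (Num.min (info_B_given_A b (coherent_mac alpha) PA PB)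
        (2^-1 * info_AB b (coherent_mac alpha) PA PB)) =
    rate b (Some alpha, PA ord_max, PB ord_max).
  by move=> dA dB; rewrite info_A_given_BE // info_B_given_AE // info_ABE.
apply: maximumE.
  exists (bernoulli s), (bernoulli t); have := bernoulli_dist s01.
  have := bernoulli_dist t01 => dt ds; split=> //.
  by rewrite (rateE _ _ ds dt) /bernoulli eqxx.
move=> _ [PA [PB [dA dB ->]]]; rewrite (rateE _ _ dA dB).
have [_ A01] := dist2 dA; have [_ B01] := dist2 dB.
exact: (maxst _ _ (conj A01 B01)).
Qed.

(** Averaging the inputs raises the sum entropy, and on the diagonal half of that entropy is the
    rate, so every sum entropy is at most twice the maximal rate. As the rate never exceeds half the
    sum entropy, the maximiser of the rate attains this bound. *)
Lemma I_max_infty_rate (s t : R) : in_cube (None, s, t) ->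
  (forall s' t', in_cube (None, s', t') ->
    rate b (None, s', t') <= rate b (None, s, t)) ->
  I_max_infty b / 2 = rate b (None, s, t).
Proof.
move=> c0 maxst.
have bound s' t' : in_cube (None, s', t') ->
    sum_info b None s' t' <= 2 * rate b (None, s, t).
  move=> [/= s01 t01]; apply: le_trans (sum_info_le_diag b1 s01 t01) _.
  have q01 : 0 <= (s' + t') / 2 <= 1.
    by move: s01 t01 => /andP[? ?] /andP[? ?]; apply/andP; split; lra.
  have := maxst ((s' + t') / 2) ((s' + t') / 2) (conj q01 q01).
  by rewrite (rate_diag b1 q01); lra.
have E : sum_info b None s t = 2 * rate b (None, s, t).
  apply/eqP; rewrite eq_le bound //=.
  by have := rate_le_sum_info b (None, s, t); rewrite /=; lra.
have objE (PA PB : 'I_2 -> R) : is_dist PA -> is_dist PB ->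
    eta b (PA ord0 * PB ord_max + PA ord_max * PB ord0)
      + eta b (PA ord0 * PB ord0) + eta b (PA ord_max * PB ord_max) =
    sum_info b None (PA ord_max) (PB ord_max).
  move=> /dist2[A0 _] /dist2[B0 _]; rewrite sum_infoE // A0 B0.
  by congr (_ + _); rewrite addrC.
have [/= s01 t01] := c0.
have -> : I_max_infty b = 2 * rate b (None, s, t); last by field.
apply: maximumE.
  exists (bernoulli s), (bernoulli t); have := bernoulli_dist s01.
  have := bernoulli_dist t01 => dt ds; split=> //.
  by rewrite (objE _ _ ds dt) /bernoulli eqxx E.
move=> _ [PA [PB [dA dB ->]]]; rewrite (objE _ _ dA dB).
have [_ A01] := dist2 dA; have [_ B01] := dist2 dB.
exact: (bound _ _ (conj A01 B01)).
Qed.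

Lemma cinfty_filter : Filter (cinfty R).
Proof.
apply: filter_from_filter; first by exists 0.
move=> M N _ _; exists (Num.max M N) => // alpha /=.
by rewrite gt_max => /andP[].
Qed.

(** With r = |alpha|, exp(2 r^2) >= 1 + 2 r^2 >= 1/d. The summand 1 in the threshold gives r >= 1,
    hence r <= r^2. *)
Lemma overlap_small (d : R) (alpha : R[i]) : 0 < d ->
  1 + d^-1 < Normc.normc alpha -> overlap alpha <= d.
Proof.
move=> d0; set r := Normc.normc alpha => dr.
have di : 0 < d^-1 by rewrite invr_gt0.
have r1 : 1 <= r by lra.
have rr : r <= r ^+ 2 by rewrite expr2 ler_peMr //; lra.
rewrite /overlap expRN -[d]invrK lef_pV2 ?posrE ?expR_gt0 //.
by apply: le_trans (expR_ge1Dx _); rewrite -/r; lra.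
Qed.

End Maxima.

Unset Implicit Arguments.

Theorem mainTheorem4 (R : realType) (b : R) (hb : 1 < b) :
  (fun alpha : R[i] => C_SD b (coherent_mac alpha)) @ cinfty R
    --> I_max_infty b / 2.
Proof.
have FF := @cinfty_filter R.
have ua := uapprox_rate hb.
have [s0 [t0 [c0 max0]]] := uapprox_max None ua.
rewrite (I_max_infty_rate hb c0 max0).
apply/cvgrPdist_le => e e0.
have [d d0 near_rate] := uapprox_unif_continuous ua e0.
exists (1 + d^-1) => //= alpha large.
have [s [t [c max]]] := uapprox_max (Some alpha) ua.
rewrite (C_SD_rate hb c max).
(* With equal input laws the two points differ only in the overlap, so the distance is
   [overlap alpha], small uniformly in the laws. *)
have close s' t' : in_cube (None, s', t') ->
    `| rate b (None, s', t') - rate b (Some alpha, s', t') | <= e.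
  move=> c'; apply: near_rate => //.
  rewrite /pdist /= !subrr !normr0 !addr0 sub0r normrN ger0_norm.
    exact: overlap_small.
  by rewrite expR_ge0.
exact: dist_maxima (close _ _ c0) (close _ _ c) (max0 _ _ c) (max _ _ c0).
Qed.
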